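(* Let $\alpha>0$, let $d\ge1$ be an integer with $d>\alpha\wedge2$, and let $D$ obey Assumption A with parameters $L\ge1$, $\alpha$, $K_D$, $\Delta$. There is a constant $K_C>0$ depending only on $K_D$ and $\Delta$ (for the given $d,\alpha$; in particular not on $L$) such that, for all $\mu\in[0,1]$ and $x\in\mathbb Z^d$: if $\alpha\neq2$, $$C_\mu(x)\le\delta_{0,x}+\frac{K_C}{L^{\alpha\wedge2}|\!|\!|x|\!|\!|_L^{d-\alpha\wedge2}}\bigg(1\wedge\frac{1}{|\!|\!|\frac xL|\!|\!|_1^{2(\alpha\wedge2)}(1-\mu)^2}\bigg),$$ and if $\alpha=2$, $$C_\mu(x)\le\delta_{0,x}+\frac{K_C}{L^2|\!|\!|x|\!|\!|_L^{d-2}\log|\!|\!|\frac xL|\!|\!|_1}\bigg(1\wedge\frac{(\log|\!|\!|\frac xL|\!|\!|_1)^2}{|\!|\!|\frac xL|\!|\!|_1^4(1-\mu)^2}\bigg).$$ (For $\mu=1$ the minima are interpreted as $1$.)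
   Context: Notation. $a\wedge b=\min\{a,b\}$. $\delta_{0,x}$ is the Kronecker delta. $|x|$ is the Euclidean norm. For $L\ge1$ and $x\in\mathbb R^d$, $|\!|\!|x|\!|\!|_L=\frac{\pi}{2}\max\{|x|,L\}$; thus $|\!|\!|x|\!|\!|_L=L|\!|\!|\frac xL|\!|\!|_1$ and $\log|\!|\!|\frac xL|\!|\!|_1\ge\log\frac\pi2>0$. $\mathbb Z^d$-symmetric means invariant under reflection in coordinate hyperplanes and rotation by $\pi/2$. $\hat f(k)=\sum_{x\in\mathbb Z^d}f(x)e^{ik\cdot x}$. Assumption A (parameters $L\ge1$, $\alpha>0$, $K_D\ge1$, $\Delta\in(0,1)$). $D:\mathbb Z^d\to[0,\infty)$ is a $\mathbb Z^d$-symmetric probability distribution with $D(0)=0$, $$\frac{K_D^{-1}L^\alpha}{|\!|\!|x|\!|\!|_L^{d+\alpha}}\le D(x)\le\frac{K_DL^\alpha}{|\!|\!|x|\!|\!|_L^{d+\alpha}}\quad(x\ne0),$$ and $1-\hat D(k)<2-\Delta$ for all $k\in(-\pi,\pi]^d$, and $1-\hat D(k)>\Delta$ for $k\in(-\pi,\pi]^d$ with $\|k\|_\infty>L^{-1}$. $C_\mu$ is the random walk two-point function: $C_\mu(x)=\sum_\omega\prod_{j=1}^{|\omega|}\mu D(\omega_j-\omega_{j-1})$, summed over all paths $\omega=(\omega_0,\dots,\omega_{|\omega|})$ in $\mathbb Z^d$ from $0$ to $x$ of any length $|\omega|\ge0$; equivalently $C_\mu(x)=\delta_{0,x}+\sum_{n\ge1}\mu^nD^{*n}(x)$,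 with $D^{*n}$ the $n$-fold convolution of $D$ with itself. *)

(* Defs.v *)
From mathcomp Require Import all_boot all_order all_algebra.
From mathcomp Require Import complex.
From mathcomp Require Import all_classical all_reals all_analysis.

Set Implicit Arguments.
Unset Strict Implicit.
Unset Printing Implicit Defensive.
Import Order.TTheory GRing.Theory Num.Theory.

Local Open Scope classical_set_scope.
Local Open Scope ring_scope.
Local Open Scope complex_scope.

(* Z^d is 'rV[int]_d and R^d is 'rV[R]_d *)
Definition vec_of_int (R : realType) (d : nat) (x : 'rV[int]_d) : 'rV[R]_d :=
  map_mx intr x.

Definition dotv (R : realType) (d : nat) (k x : 'rV[R]_d) : R :=
  \sum_(i < d) k 0 i * x 0 i.

Definition eucl_norm (R : realType) (d : nat) (x : 'rV[R]_d) : R :=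
  Num.sqrt (\sum_(i < d) x 0 i ^+ 2).

Definition max_norm (R : realType) (d : nat) (k : 'rV[R]_d) : R :=
  \big[Num.max/0]_(i < d) `|k 0 i|.

(* |||x|||_L *)
Definition tnorm (R : realType) (d : nat) (L : R) (x : 'rV[R]_d) : R :=
  pi / 2 * Num.max (eucl_norm x) L.

Definition reflection (d : nat) (i : 'I_d) (x : 'rV[int]_d) : 'rV[int]_d :=
  \row_k (if k == i then - x 0 i else x 0 k).

Definition rotation (d : nat) (i j : 'I_d) (x : 'rV[int]_d) : 'rV[int]_d :=
  \row_k (if k == i then - x 0 j else if k == j then x 0 i else x 0 k).

Definition Zd_symmetric (R : realType) (d : nat) (f : 'rV[int]_d -> R) : Prop :=
  (forall (i : 'I_d) (x : 'rV[int]_d), f (reflection i x) = f x) /\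
  (forall (i j : 'I_d) (x : 'rV[int]_d), i != j -> f (rotation i j x) = f x).

(* Unconditional sums of absolutely summable families; esum itself is only
   meaningful for nonnegative terms. *)
Definition rsum (R : realType) (T : choiceType) (f : T -> R) : R :=
  fine (\esum_(x in [set: T]) ((EFin \o f)^\+ x)
        - \esum_(x in [set: T]) ((EFin \o f)^\- x))%E.

Definition csum (R : realType) (T : choiceType) (f : T -> R[i]) : R[i] :=
  rsum (fun x => complex.Re (f x)) +i* rsum (fun x => complex.Im (f x)).

Definition expi (R : realType) (t : R) : R[i] := cos t +i* sin t.

Definition fourier (R : realType) (d : nat) (f : 'rV[int]_d -> R)
    (k : 'rV[R]_d) : R[i] :=
  csum (fun x : 'rV[int]_d => (f x)%:C * expi (dotv k (vec_of_int R x))).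

(* In the last two fields the order is that of R[i]: z < w means that
   Im z = Im w and Re z < Re w; the transform is real by symmetry. *)
Record assumptionA (R : realType) (d : nat) (L alpha KD Delta : R)
    (D : 'rV[int]_d -> R) : Prop := AssumptionA {
  D_ge0 : forall x : 'rV[int]_d, 0 <= D x ;
  D_sum1 : (\esum_(x in [set: 'rV[int]_d]) (D x)%:E = 1)%E ;
  D_sym : Zd_symmetric D ;
  D_0 : D 0 = 0 ;
  D_lower : forall x : 'rV[int]_d, x != 0 ->
    KD^-1 * L `^ alpha / tnorm L (vec_of_int R x) `^ (d%:R + alpha) <= D x ;
  D_upper : forall x : 'rV[int]_d, x != 0 ->
    D x <= KD * L `^ alpha / tnorm L (vec_of_int R x) `^ (d%:R + alpha) ;
  D_hat_lt : forall k : 'rV[R]_d, (forall i : 'I_d, - pi < k 0 i <= pi) ->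
    1 - fourier D k < (2 - Delta)%:C ;
  D_hat_gt : forall k : 'rV[R]_d, (forall i : 'I_d, - pi < k 0 i <= pi) ->
    L^-1 < max_norm k -> Delta%:C < 1 - fourier D k
}.

(* A path omega is the nonempty sequence (omega_0, ..., omega_n) of its n + 1
   sites, so that |omega| = n = (size omega).-1. *)
Definition paths (d : nat) (x : 'rV[int]_d) : set (seq 'rV[int]_d) :=
  [set w | [/\ (0 < size w)%N, w`_0 = 0 & last 0 w = x]].

Definition path_weight (R : realType) (d : nat) (D : 'rV[int]_d -> R) (mu : R)
    (w : seq 'rV[int]_d) : R :=
  \prod_(1 <= j < size w) (mu * D (w`_j - w`_j.-1)).

(* Extended real valued: finiteness is not presupposed. *)
Definition two_point (R : realType) (d : nat) (D : 'rV[int]_d -> R) (mu : R)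
    (x : 'rV[int]_d) : \bar R :=
  \esum_(w in paths x) (path_weight D mu w)%:E.

(* 1 /\ a / (b (1 - mu)^2), read as 1 at mu = 1; the case split is needed
   because division by 0 yields 0. *)
Definition min1_massive (R : realType) (mu a b : R) : R :=
  if mu == 1 then 1 else Num.min 1 (a / (b * (1 - mu) ^+ 2)).

(* Main.v *)
Require Import Defs.
From mathcomp Require Import all_boot all_order all_algebra.
From mathcomp Require Import all_classical all_reals all_analysis.
From mathcomp Require Import ring lra zify.

Set Implicit Arguments.
Unset Strict Implicit.
Unset Printing Implicit Defensive.
Import Order.TTheory GRing.Theory Num.Theory.

Local Open Scope classical_set_scope.
Local Open Scope ring_scope.

(** The bound is a Green function estimate, obtained by summing heat kernel
bounds over the number of steps.  Write p_n for the n-fold convolution of D,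
l for the integer part of L, and g = 2^(-alpha).  Space is measured by the
scales 2^J l, and time by
   theta J = 4^J / Psi J,   Psi J = 1 + 4g + ... + (4g)^J,
the time the walk takes to move by 2^J l: steps of length about 2^j l have
probability about g^j, so the displacements of size at most 2^J l contribute
about l^2 Psi J to the variance of one step.  The geometric sum Psi treats all
alpha at once: its ratio 4g is above, at or below 1 according to whether alpha
is below, at or above 2, so theta J is of order 2^(J min(alpha, 2)), or
4^J / (J + 1) when alpha = 2, which is where the logarithm comes from.

Two bounds hold with constants that do not depend on L:
- p_n(x) <= C l^(-d) 2^(-dJ) for n >= theta J  [sup_heat_kernel_bound];
- p_n(x) <= C l^(-d) 2^(-dJ) n / theta J for all n >= 1, when |x| is at least
  a large multiple of 2^J l  [tail_heat_kernel_bound].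

The first is Nash's argument in discrete time.  The function
e(y) = p_2n(0) - p_2n(y) is half the squared l^2 distance between p_n and its
translate by y, hence e(y + z) <= 2 e(y) + 2 e(z).  As
p_2n(0) - p_(2n+2)(0) is the p_2-average of e, and p_2 dominates a multi-scale
combination of uniform distributions on cubes, this one-step decrease controls
e(y) for |y| <= 2^J l, up to the factor theta J [energy_lower].  Averaging e
over a cube gives a difference inequality for the return probability
[nash_inequality], which is integrated by doubling n [return_prob_decay].

The second truncates the steps at 2^J l.  The error is at most n times the
supremum of D beyond 2^J l [big_jump].  For the truncated walk, an exponential
moment, tilted more strongly the smaller n / theta J is, gives a tail
probability smaller than any prescribed power of n / theta J
[tail_mass_small]; that power pays for the use of the first bound at a time
shorter than theta J [decay_loss].

If |x| is of order 2^J l, then summing the second bound over n < theta J and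
the first over n >= theta J gives C l^(-d) 2^(-dJ) theta J, the second part
being geometric because d > min(alpha, 2) [theta_decay]; summing
mu^n n <= (1 - mu)^(-2) against the second bound gives the decay in
1 - mu [green_bound].  It remains to bound a sum over paths by the sum over n
[two_point_le] and to express theta J through |||x|||_L. *)

(** * Sums of nonnegative functions *)

Lemma eq_ler (R : realType) (x y : R) : x = y -> x <= y.
Proof. by move->. Qed.

Section Tsum.
Variables (R : realType) (T : choiceType).
Implicit Types f g : T -> R.

(** Real-valued, so that field tactics apply; meaningful when summ holds. *)
Definition tsum f : R := fine (\esum_(x in [set: T]) (f x)%:E).

Definition summ f : Prop :=
  (forall x, 0 <= f x) /\ (\esum_(x in [set: T]) (f x)%:E < +oo)%E.

Lemma summ_ge0 f x : summ f -> 0 <= f x. Proof. by case=> f0 _; apply: f0. Qed.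

Lemma tsumE f : summ f -> (\esum_(x in [set: T]) (f x)%:E = (tsum f)%:E)%E.
Proof.
move=> [f0 fs]; rewrite /tsum fineK// fin_numElt fs andbT.
by rewrite (lt_le_trans (ltNyr 0))//; apply: esum_ge0 => x _; rewrite lee_fin.
Qed.

Lemma tsum_ge0 f : (forall x, 0 <= f x) -> 0 <= tsum f.
Proof. by move=> f0; apply: fine_ge0; apply: esum_ge0 => x _; rewrite lee_fin. Qed.

Lemma summ_le f g : (forall x, 0 <= f x) -> (forall x, f x <= g x) -> summ g -> summ f.
Proof.
move=> f0 fg [g0 gs]; split=> //; apply: le_lt_trans gs.
by apply: le_esum => x _; rewrite lee_fin.
Qed.

Lemma tsum_le f g : (forall x, 0 <= f x) -> (forall x, f x <= g x) -> summ g ->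
  tsum f <= tsum g.
Proof.
move=> f0 fg gs; rewrite -lee_fin -!tsumE//; last exact: summ_le gs.
by apply: le_esum => x _; rewrite lee_fin.
Qed.

Lemma summ_tsumE f s : (forall x, 0 <= f x) ->
  (\esum_(x in [set: T]) (f x)%:E = s%:E)%E -> summ f /\ tsum f = s.
Proof. by move=> f0 E; split; [split=> //; rewrite E ltry|rewrite /tsum E]. Qed.

Lemma tsumD f g : summ f -> summ g ->
  summ (fun x => f x + g x) /\ tsum (fun x => f x + g x) = tsum f + tsum g.
Proof.
move=> fs gs; apply: summ_tsumE => [x|]; first by rewrite addr_ge0// summ_ge0.
rewrite EFinD -!tsumE// -esumD//; first last.
- by move=> x _; rewrite lee_fin summ_ge0.
- by move=> x _; rewrite lee_fin summ_ge0.
Qed.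

Lemma tsumB f g : summ f -> (forall x, 0 <= g x <= f x) ->
  summ (fun x => f x - g x) /\ tsum (fun x => f x - g x) = tsum f - tsum g.
Proof.
move=> fs gf.
have gs : summ g by apply: summ_le fs => x; case/andP: (gf x).
have ds : summ (fun x => f x - g x).
  by apply: summ_le fs => x; case/andP: (gf x) => g0 g1; rewrite ?subr_ge0// gerBl.
split=> //; have [_] := tsumD ds gs.
rewrite (_ : (fun x => _) = f); first by move->; rewrite addrK.
by apply/funext => x; rewrite subrK.
Qed.

Lemma tsum_fset_le f (s : seq T) : uniq s -> summ f -> \sum_(x <- s) f x <= tsum f.
Proof.
move=> us fs; rewrite -lee_fin -tsumE//; apply: esum_ge.
exists [set` s]; first by split=> //; apply: finite_seq.
by rewrite -sumEFin fsbig_seq.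
Qed.

Lemma tsum_pt f x : summ f -> f x <= tsum f.
Proof. by move=> fs; have := @tsum_fset_le f [:: x] isT fs; rewrite big_seq1. Qed.

Lemma summ_fset f B : (forall x, 0 <= f x) ->
  (forall s : seq T, uniq s -> \sum_(x <- s) f x <= B) -> summ f /\ tsum f <= B.
Proof.
move=> f0 fB.
have H : (\esum_(x in [set: T]) (f x)%:E <= B%:E)%E.
  apply: ge_ereal_sup => _ [X [finX _] <-].
  by rewrite fsbig_finite// sumEFin lee_fin fB.
have fs : summ f by split=> //; rewrite (le_lt_trans H)// ltry.
by split=> //; rewrite -lee_fin -tsumE.
Qed.

Lemma tsumZ c f : 0 <= c -> summ f ->
  summ (fun x => c * f x) /\ tsum (fun x => c * f x) = c * tsum f.
Proof.
move=> c0 fs.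
have le_cf c' f' : 0 <= c' -> summ f' ->
    summ (fun x => c' * f' x) /\ tsum (fun x => c' * f' x) <= c' * tsum f'.
  move=> c'0 f's; apply: summ_fset => [x|s us]; first by rewrite mulr_ge0// summ_ge0.
  by rewrite -mulr_sumr ler_wpM2l// tsum_fset_le.
have [cs cle] := le_cf c f c0 fs; split=> //; apply/eqP; rewrite eq_le cle/=.
have [->|cn0] := eqVneq c 0; first by rewrite mul0r tsum_ge0// => x; rewrite mul0r.
have cgt0 : 0 < c by rewrite lt_def cn0.
have [_] := le_cf c^-1 _ (ltW (etrans (invr_gt0 c) cgt0)) cs.
rewrite (_ : (fun x => _) = f); last by apply/funext => x; rewrite mulKf.
by rewrite mulrC ler_pdivlMr// mulrC.
Qed.

Lemma tsumZr c f : 0 <= c -> summ f ->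
  summ (fun x => f x * c) /\ tsum (fun x => f x * c) = tsum f * c.
Proof.
move=> c0 fs; have := tsumZ c0 fs; rewrite mulrC.
by under eq_fun do rewrite mulrC.
Qed.

Lemma tsum_delta a f : (forall x, x != a -> f x = 0) -> 0 <= f a ->
  summ f /\ tsum f = f a.
Proof.
move=> fa f0.
have fge0 x : 0 <= f x by have [->//|/fa->] := eqVneq x a.
apply: summ_tsumE => //.
rewrite -(@esum_set1 R T a (fun x => (f x)%:E))// [RHS]esum_mkcond.
apply: eq_esum => x _; case: ifPn => //; rewrite notin_setE/= => /eqP xa.
by rewrite fa.
Qed.

Lemma tsum_sum (I : Type) (s : seq I) (F : I -> T -> R) : (forall i, summ (F i)) ->
  summ (fun x => \sum_(i <- s) F i x) /\
  tsum (fun x => \sum_(i <- s) F i x) = \sum_(i <- s) tsum (F i).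
Proof.
move=> Fs; elim: s => [|i s [IHs IHe]].
  rewrite big_nil; under eq_fun do rewrite big_nil.
  apply: summ_tsumE => //; exact: esum1.
rewrite big_cons -IHe; under eq_fun do rewrite big_cons.
exact: tsumD.
Qed.

Lemma tsum_reindex (e e' : T -> T) f : cancel e e' -> cancel e' e -> summ f ->
  summ (fun x => f (e x)) /\ tsum (fun x => f (e x)) = tsum f.
Proof.
move=> K K' fs; apply: summ_tsumE => [x|]; first exact: summ_ge0.
rewrite -tsumE//; symmetry; apply: (@reindex_esum R T T setT setT e (fun x => (f x)%:E)).
split=> // [x y _ _ /(congr1 e')|y _]; first by rewrite !K.
by exists (e' y).
Qed.

(** Tonelli: only one of the two orders of summation has to be known finite. *)
Lemma tsum_swap (F : T -> T -> R) : (forall x, summ (F x)) ->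
  summ (fun x => tsum (F x)) ->
  [/\ forall y, summ (F^~ y), summ (fun y => tsum (F^~ y)) &
   tsum (fun y => tsum (F^~ y)) = tsum (fun x => tsum (F x))].
Proof.
move=> Fs Ss.
have F0 x y : 0 <= F x y by exact: summ_ge0.
have Fsy y : summ (F^~ y) by apply: summ_le Ss => // x; apply: tsum_pt.
have [] // := @summ_tsumE (fun y => tsum (F^~ y)) (tsum (fun x => tsum (F x))).
  by move=> x; apply: tsum_ge0.
rewrite -tsumE//.
transitivity (\esum_(y in [set: T]) \esum_(x in [set: T]) (F x y)%:E)%E.
  by apply: eq_esum => y _; rewrite tsumE.
transitivity (\esum_(x in [set: T]) \esum_(y in [set: T]) (F x y)%:E)%E; last first.
  by apply: eq_esum => x _; rewrite tsumE.
rewrite !esum_esum; do ?by move=> *; rewrite lee_fin.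
rewrite (@reindex_esum R _ _ ([set: T] `*`` fun=> setT) ([set: T] `*`` fun=> setT) (fun k
  => (k.2, k.1)))//.
split=> //= [[a b] [c e] _ _ /= [-> ->]//|[a b] _].
by exists (b, a).
Qed.

End Tsum.

(** * Convolution on an abelian group and its energy form *)

Section Conv.
Variables (R : realType) (V : zmodType).
Implicit Types (f g h : V -> R) (x y z : V) (n : nat).

Definition convol f g : V -> R := fun x => tsum (fun y => f y * g (x - y)).

Definition delta0 : V -> R := fun x => (x == 0)%:R.

(** The n-step transition probability from 0 when f is the step distribution. *)
Definition cpow f n : V -> R := iter n (convol f) delta0.

Lemma tsum_shift f a : summ f ->
  summ (fun x => f (x + a)) /\ tsum (fun x => f (x + a)) = tsum f.
Proof. by apply: (tsum_reindex (e' := fun x => x - a)) => x; rewrite ?addrK ?subrK. Qed.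

Lemma tsum_refl f a : summ f ->
  summ (fun x => f (a - x)) /\ tsum (fun x => f (a - x)) = tsum f.
Proof. by apply: (tsum_reindex (e' := fun x => a - x)) => x; rewrite subKr. Qed.

Lemma convol_term_summ f g x : summ f -> summ g -> summ (fun y => f y * g (x - y)).
Proof.
move=> fs gs.
apply: (summ_le (g := fun y => f y * tsum g)).
- by move=> y; rewrite mulr_ge0 ?summ_ge0.
- by move=> y; rewrite ler_wpM2l ?summ_ge0 ?tsum_pt.
- by apply: (tsumZr _ fs).1; apply: tsum_ge0 => y; apply: summ_ge0.
Qed.

Lemma convol_summ f g : summ f -> summ g ->
  summ (convol f g) /\ tsum (convol f g) = tsum f * tsum g.
Proof.
move=> fs gs; pose F y x := f y * g (x - y).
have FE y : summ (F y) /\ tsum (F y) = f y * tsum g.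
  have [gs' <-] := tsum_shift (- y) gs.
  by apply: tsumZ => //; apply: summ_ge0.
have tg0 : 0 <= tsum g by apply: tsum_ge0 => y; apply: summ_ge0.
have E : (fun y => tsum (F y)) = (fun y => f y * tsum g).
  by apply/funext => y; rewrite (FE y).2.
have [fgs fge] := tsumZr tg0 fs.
have [||_ h1 h2] := @tsum_swap _ _ F; first by move=> y; apply: (FE y).1.
  by rewrite E.
by split=> //; rewrite -fge -E -h2.
Qed.

Lemma convolC f g : summ f -> summ g -> convol f g = convol g f.
Proof.
move=> fs gs; apply/funext => x; rewrite /convol.
have [_ <-] := tsum_refl x (convol_term_summ x gs fs).
by congr tsum; apply/funext => y; rewrite subKr mulrC.
Qed.

Lemma convolA f g h : summ f -> summ g -> summ h ->
  convol (convol f g) h = convol f (convol g h).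
Proof.
move=> fs gs hs; apply/funext => x.
pose F y z := f y * (g (z - y) * h (x - z)).
have inner y : summ (fun z => g (z - y) * h (x - z)) /\
    tsum (fun z => g (z - y) * h (x - z)) = convol g h (x - y).
  have [] := tsum_shift (- y) (convol_term_summ (x - y) gs hs).
  rewrite -[tsum _ = _]/(_ = convol g h (x - y)).
  under eq_fun do rewrite opprD opprK addrACA addNr addr0.
  by [].
have FE y : summ (F y) /\ tsum (F y) = f y * convol g h (x - y).
  by rewrite -(inner y).2; apply: tsumZ; [exact: summ_ge0|exact: (inner y).1].
have E : (fun y => tsum (F y)) = (fun y => f y * convol g h (x - y)).
  by apply/funext => y; rewrite (FE y).2.
have [ghs _] := convol_summ gs hs.
have [||_ h1 h2] := @tsum_swap _ _ F; first by move=> y; apply: (FE y).1.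
  by rewrite E; apply: convol_term_summ.
rewrite /convol -/(convol f g) -/(convol g h) -E -h2.
congr tsum; apply/funext => z.
have [_ e] := tsumZr (summ_ge0 (x - z) hs) (convol_term_summ z fs gs).
by rewrite /convol -e; congr tsum; apply/funext => y; rewrite /F mulrA.
Qed.

Lemma delta0_summ : summ delta0 /\ tsum delta0 = 1.
Proof.
have [||? ->] := @tsum_delta R V 0 delta0; rewrite /delta0 ?eqxx//.
by move=> x /negbTE->.
Qed.

Lemma convol_delta0 f : summ f -> convol f delta0 = f.
Proof.
move=> fs; apply/funext => x; rewrite /convol.
have [||_ ->] := @tsum_delta R V x (fun y => f y * delta0 (x - y)).
- by move=> y; rewrite /delta0 subr_eq0 eq_sym => /negbTE->; rewrite mulr0.
- by rewrite mulr_ge0 ?ler0n// summ_ge0.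
- by rewrite /delta0 subrr eqxx mulr1.
Qed.

Lemma cpow_summ f n : summ f -> summ (cpow f n) /\ tsum (cpow f n) = tsum f ^+ n.
Proof.
move=> fs; elim: n => [|n [IH1 IH2]] /=; first by rewrite expr0; exact: delta0_summ.
by have [? ->] := convol_summ fs IH1; rewrite IH2 exprS.
Qed.

Lemma cpowS f n : cpow f n.+1 = convol f (cpow f n). Proof. by []. Qed.

Lemma cpow1 f : summ f -> cpow f 1 = f. Proof. exact: convol_delta0. Qed.

Lemma cpowD f m n : summ f -> cpow f (m + n) = convol (cpow f m) (cpow f n).
Proof.
move=> fs; have ps k : summ (cpow f k) by case: (cpow_summ k fs).
elim: m => [|m IH]; last by rewrite addSn !cpowS IH convolA.
by rewrite add0n convolC// convol_delta0.
Qed.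

Lemma convol_le f f' g g' x : (forall y, 0 <= f y <= f' y) -> (forall y, 0 <= g y <= g' y) ->
  summ f' -> summ g' -> convol f g x <= convol f' g' x.
Proof.
move=> ff' gg' fs gs; apply: tsum_le => [y|y|]; last exact: convol_term_summ.
- by case/andP: (ff' y) => ? _; case/andP: (gg' (x - y)) => ? _; rewrite mulr_ge0.
- by case/andP: (ff' y) => ? ?; case/andP: (gg' (x - y)) => ? ?; rewrite ler_pM.
Qed.

Lemma convol_sup f g x B : summ f -> (forall y, 0 <= g y <= B) -> convol f g x <= tsum f * B.
Proof.
move=> fs gB; have B0 : 0 <= B by case/andP: (gB 0) => /le_trans; apply.
have [s <-] := tsumZr B0 fs; apply: tsum_le => // y; case/andP: (gB (x - y)) => g0 g1.
  exact: mulr_ge0 (summ_ge0 _ fs) g0.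
exact: ler_wpM2l (summ_ge0 _ fs) _ _ g1.
Qed.

Lemma convol_even f g : summ f -> summ g -> (forall x, f (- x) = f x) ->
  (forall x, g (- x) = g x) ->
  forall x, convol f g (- x) = convol f g x.
Proof.
move=> fs gs fe ge x; rewrite /convol.
have [_ <-] := tsum_refl 0 (convol_term_summ (- x) fs gs).
congr tsum; apply/funext => y.
by rewrite sub0r fe -[in RHS]ge; congr (_ * g _); rewrite !opprD !opprK addrC.
Qed.

Lemma cpow_even f n : summ f -> (forall x, f (- x) = f x) ->
  forall x, cpow f n (- x) = cpow f n x.
Proof.
move=> fs fe; elim: n => [|n IH] x; first by rewrite /= /delta0 oppr_eq0.
by rewrite cpowS convol_even//; case: (cpow_summ n fs).
Qed.

(** For even f the convolution square is the autocorrelation of f, so its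
drop from 0 to y measures how much f moves under translation by y. *)
Lemma energyE f y : summ f -> (forall x, f (- x) = f x) ->
  summ (fun x => (f (x + y) - f x) ^+ 2) /\
  tsum (fun x => (f (x + y) - f x) ^+ 2) = 2 * (convol f f 0 - convol f f y).
Proof.
move=> fs fe.
have c0 : summ (fun x => f x * f x) /\ tsum (fun x => f x * f x) = convol f f 0.
  have := convol_term_summ 0 fs fs; rewrite /convol.
  by under eq_fun do rewrite sub0r fe.
have [sy ey] := tsum_shift y c0.1; rewrite c0.2 in ey.
have cy : summ (fun x => f (x + y) * f x) /\ tsum (fun x => f (x + y) * f x) = convol f f y.
  have [] := tsum_shift y (convol_term_summ y fs fs).
  rewrite -[tsum _ = _]/(_ = convol f f y).
  under eq_fun do rewrite (addrC _ y) opprD addNKr fe addrC.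
  by [].
have [s1 e1] := tsumD sy c0.1.
have [s2 e2] := tsumZ (ler0n _ 2) cy.1.
have [|s3 e3] := tsumB s1 (g := fun x => 2 * (f (x + y) * f x)).
  move=> x; apply/andP; split; first by apply: (summ_ge0 _ s2).
  rewrite -subr_ge0.
  rewrite [X in 0 <= X](_ : _ = (f (x + y) - f x) ^+ 2) ?sqr_ge0//.
  by ring.
have E : (fun x => (f (x + y) - f x) ^+ 2) =
   (fun x => f (x + y) * f (x + y) + f x * f x - 2 * (f (x + y) * f x)).
  by apply/funext => x; ring.
rewrite E; split=> //; rewrite e3 e1 e2 c0.2 ey cy.2; by ring.
Qed.

(** The drop is half a sum of squares. *)
Lemma energy_ge0 f y : summ f -> (forall x, f (- x) = f x) -> convol f f y <= convol f f 0.
Proof.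
move=> fs fe; have [_ e] := energyE y fs fe.
rewrite -subr_ge0 -(@pmulr_rge0 _ 2)// -e; apply: tsum_ge0 => x; exact: sqr_ge0.
Qed.

(** A translation by y + z is one by y followed by one by z, and
(a + b)^2 <= 2 a^2 + 2 b^2. *)
Lemma energyD f y z : summ f -> (forall x, f (- x) = f x) ->
  convol f f 0 - convol f f (y + z) <=
  2 * (convol f f 0 - convol f f y) + 2 * (convol f f 0 - convol f f z).
Proof.
move=> fs fe; have [_ e] := energyE (y + z) fs fe.
have [sy ey] := energyE y fs fe; have [sz ez] := energyE z fs fe.
rewrite -(@ler_pM2l _ 2)// -e mulrDr mulrCA -ey (mulrCA 2 2) -ez.
have [s1 e1] := tsumZ (ler0n _ 2) sy.
have [s2 <-] := tsumZ (ler0n _ 2) sz.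
have [s1' e1'] := tsum_shift z s1; rewrite -e1 -e1'.
have [s3 <-] := tsumD s1' s2; apply: tsum_le => // x; first exact: sqr_ge0.
rewrite (addrC y) addrA -subr_ge0.
set a := f (x + z + y); set b := f (x + z); set c := f x.
rewrite [X in 0 <= X](_ : _ = (a - 2 * b + c) ^+ 2) ?sqr_ge0//.
by ring.
Qed.

(** Nash's inequality needs the l^1 norm of f only through this: the
autocorrelation has total mass the square of that norm, so its average over a
large set is small. *)
Lemma nash_avg f (s : seq V) : uniq s -> summ f ->
  \sum_(y <- s) convol f f y <= tsum f ^+ 2.
Proof.
move=> us fs; have [cs ce] := convol_summ fs fs.
by rewrite expr2 -ce; apply: tsum_fset_le.
Qed.

End Conv.

(** * Cubes of the integer lattice *)

Lemma absz_leD (a b : int) : (absz (a + b)%R <= absz a + absz b)%N.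
Proof. lia. Qed.

Section Cube.
Variable d : nat.
Local Notation V := 'rV[int]_d.
Implicit Types (x y z : V) (n : nat).

Definition supnorm x : nat := (\max_(i < d) absz (x 0%R i))%N.

Lemma supnorm_leP x n : reflect (forall i, (absz (x 0%R i) <= n)%N) (supnorm x <= n)%N.
Proof.
apply: (iffP (bigmax_leqP _ _ _)) => H i; first exact: H.
by move=> _; exact: H.
Qed.

Lemma supnorm_coord x i : (absz (x 0%R i) <= supnorm x)%N.
Proof. by apply/supnorm_leP: i. Qed.

Lemma supnormN x : supnorm (- x) = supnorm x.
Proof. by apply: eq_bigr => i _; rewrite mxE abszN. Qed.

Lemma supnormD x y : (supnorm (x + y) <= supnorm x + supnorm y)%N.
Proof.
apply/supnorm_leP => i; rewrite mxE.
exact: leq_trans (absz_leD _ _) (leq_add (supnorm_coord _ _) (supnorm_coord _ _)).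
Qed.

Lemma supnorm0 : supnorm 0 = 0%N.
Proof. by apply/eqP; rewrite -leqn0; apply/supnorm_leP => i; rewrite mxE. Qed.

(** Halving is done in the integers, so no rounding error accumulates when it
is iterated. *)
Lemma supnorm_half x n : (supnorm x <= 2 * n)%N ->
  exists y z, [/\ x = y + z, (supnorm y <= n)%N & (supnorm z <= n)%N].
Proof.
move=> /supnorm_leP xn.
exists (\row_i divz (x 0 i) 2), (\row_i (x 0 i - divz (x 0 i) 2)); split.
- by apply/rowP => i; rewrite !mxE addrC subrK.
- by apply/supnorm_leP => i; rewrite mxE; have := xn i; lia.
- by apply/supnorm_leP => i; rewrite mxE; have := xn i; lia.
Qed.

Definition cube_pt n (M : 'rV['I_(2 * n).+1]_d) : V :=
  \row_i ((M 0 i : nat)%:Z - n%:Z).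

Definition cube n : seq V := [seq cube_pt M | M <- enum {: 'rV['I_(2 * n).+1]_d}].

Lemma cube_uniq n : uniq (cube n).
Proof.
rewrite map_inj_uniq ?enum_uniq// => M N /rowP e; apply/rowP => i.
by have := e i; rewrite !mxE => h; apply: val_inj => /=; lia.
Qed.

Lemma mem_cube n x : (x \in cube n) = (supnorm x <= n)%N.
Proof.
apply/mapP/supnorm_leP => [[M _ ->] i|xn].
  by rewrite mxE; case: (M 0 i) => k /= kn; lia.
exists (\row_i inord (absz (x 0 i + n%:Z))); first by rewrite mem_enum.
apply/rowP => i; rewrite !mxE inordK; move: (x 0 i) (xn i) => a; lia.
Qed.

Lemma size_cube n : size (cube n) = ((2 * n).+1 ^ d)%N.
Proof. by rewrite size_map -cardE card_mx card_ord mul1n. Qed.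

Lemma sum_subseq (R : realType) (s1 s2 : seq V) (f : V -> R) : uniq s1 -> uniq s2 ->
  {subset s1 <= s2} -> (forall x, 0 <= f x) -> \sum_(x <- s1) f x <= \sum_(x <- s2) f x.
Proof.
move=> u1 u2 s12 f0; rewrite [leRHS](bigID (mem s1))/=.
rewrite -[X in _ <= X + _]big_filter.
have E : perm_eq s1 [seq i <- s2 | i \in s1].
  apply: uniq_perm; rewrite ?filter_uniq// => x; rewrite mem_filter.
  by have := s12 x; case: (x \in s1) => // ->.
by rewrite (perm_big _ E) lerDl; apply: sumr_ge0 => x _; exact: f0.
Qed.

(** Compare w with all points of a cube through w = (w + z) - z; both z and
w + z stay in the doubled cube.  Here e is an energy, as in energyD. *)
Lemma cube_avg (R : realType) (e : V -> R) n w :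
  (forall y, 0 <= e y) -> (forall y, e (- y) = e y) ->
  (forall y z, e (y + z) <= 2 * e y + 2 * e z) -> (supnorm w <= n)%N ->
  ((2 * n).+1 ^ d)%:R * e w <= 4 * \sum_(z <- cube (2 * n)) e z.
Proof.
move=> e0 eN eD wn.
have -> : ((2 * n).+1 ^ d)%:R * e w = \sum_(z <- cube n) e w.
  by rewrite big_const_seq count_predT size_cube iter_addr_0 mulr_natl.
have sub2 : {subset cube n <= cube (2 * n)}.
  by move=> z; rewrite !mem_cube; lia.
have h1 : \sum_(z <- cube n) e z <= \sum_(z <- cube (2 * n)) e z.
  by apply: sum_subseq; rewrite ?cube_uniq.
have h2 : \sum_(z <- cube n) e (w + z) <= \sum_(z <- cube (2 * n)) e z.
  rewrite -(big_map (fun z => w + z) predT e); apply: sum_subseq; rewrite ?cube_uniq//.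
    by rewrite map_inj_uniq ?cube_uniq//; apply: addrI.
  by move=> _ /mapP[z + ->]; rewrite !mem_cube; have := supnormD w z; lia.
apply: (@le_trans _ _ (\sum_(z <- cube n) (2 * e (w + z) + 2 * e z))).
  apply: ler_sum => z _; have := eD (w + z) (- z).
  by rewrite addrK eN.
rewrite big_split/= -!mulr_sumr; lra.
Qed.

(** Each halving of y costs the factor 4 of (a + b)^2 <= 2 (a^2 + b^2)
applied to equal halves, that is, e grows at most quadratically. *)
Lemma double_energy (R : realType) (e : V -> R) n B k :
  (forall y z, e (y + z) <= 2 * e y + 2 * e z) ->
  (forall y, (supnorm y <= n)%N -> e y <= B) ->
  forall y, (supnorm y <= 2 ^ k * n)%N -> e y <= 4 ^+ k * B.
Proof.
move=> eD eB; elim: k => [|k IH] y; first by rewrite mul1n expr0 mul1r; apply: eB.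
rewrite expnS -mulnA => /supnorm_half[y1 [y2 [-> h1 h2]]].
apply: le_trans (eD _ _) _; have := IH _ h1; have := IH _ h2.
by rewrite exprS -mulrA; lra.
Qed.

End Cube.

(** * The time scale theta *)

Section Theta.
Variables (R : realType) (g : R).
Hypotheses (g_gt0 : 0 < g) (g_lt1 : g < 1).
Implicit Types (i j k J : nat).

(** Up to a factor, l^2 Psi J is the variance of one step truncated at
distance 2^J l; see second_moment below. *)
Definition Psi J : R := \sum_(j < J.+1) (4 * g) ^+ j.
(** The number of steps after which the accumulated variance l^2 n Psi J
reaches (2^J l)^2. *)
Definition theta J : R := 4 ^+ J / Psi J.

Let b0 : 0 < 4 * g. Proof. by rewrite mulr_gt0. Qed.

Lemma Psi0 : Psi 0 = 1. Proof. by rewrite /Psi big_ord1 expr0. Qed.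

Lemma PsiS J : Psi J.+1 = 1 + 4 * g * Psi J.
Proof.
rewrite /Psi big_ord_recl expr0 mulr_sumr; congr (_ + _).
by apply: eq_bigr => i _; rewrite exprS.
Qed.

Lemma PsiSr J : Psi J.+1 = Psi J + (4 * g) ^+ J.+1.
Proof. by rewrite /Psi big_ord_recr. Qed.

Lemma Psi_ge1 J : 1 <= Psi J.
Proof.
elim: J => [|J IH]; first by rewrite Psi0.
by rewrite PsiS lerDl mulr_ge0 ?(ltW b0)// (le_trans _ IH).
Qed.

Lemma Psi_gt0 J : 0 < Psi J. Proof. exact: lt_le_trans ltr01 (Psi_ge1 J). Qed.

Lemma Psi_nd J : Psi J <= Psi J.+1.
Proof. by rewrite PsiSr lerDl exprn_ge0// ltW. Qed.

Lemma expr_le_Psi J : (4 * g) ^+ J <= Psi J.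
Proof.
case: J => [|J]; first by rewrite Psi0 expr0.
by rewrite PsiSr lerDr ltW// Psi_gt0.
Qed.

(** Psi (i + j) is a sum of monomials each of which is a product of a monomial
of Psi i and one of Psi j. *)
Lemma Psi_submul i j : Psi (i + j) <= Psi i * Psi j.
Proof.
elim: i => [|i IH]; first by rewrite Psi0 mul1r.
rewrite addSn PsiS (PsiS i) [leRHS]mulrDl mul1r; apply: lerD; first exact: Psi_ge1.
rewrite -[leRHS]mulrA ler_wpM2l//.
exact: ltW.
Qed.

Lemma theta0 : theta 0 = 1. Proof. by rewrite /theta Psi0 expr0 divr1. Qed.

Lemma theta_gt0 J : 0 < theta J.
Proof. by rewrite divr_gt0 ?exprn_gt0 ?Psi_gt0. Qed.

Lemma theta_le4 J : theta J.+1 <= 4 * theta J.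
Proof.
rewrite /theta mulrA -exprS ler_wpM2l ?exprn_ge0//.
by rewrite lef_pV2 ?posrE ?Psi_gt0 ?Psi_nd.
Qed.

Lemma theta_leg J : theta J.+1 <= g^-1 * theta J.
Proof.
rewrite /theta ler_pdivrMr ?Psi_gt0// exprS PsiS.
have P := Psi_gt0 J.
rewrite [leRHS](_ : _ = 4 * 4 ^+ J + 4 ^+ J / (g * Psi J)).
  by rewrite lerDl divr_ge0 ?exprn_ge0 ?mulr_ge0 ?ltW.
field; by rewrite !gt_eqF.
Qed.

Lemma theta_supmul i j : theta i * theta j <= theta (i + j).
Proof.
rewrite /theta mulrACA -exprD -invfM ler_wpM2l ?exprn_ge0//.
by rewrite lef_pV2 ?posrE ?mulr_gt0 ?Psi_gt0 ?Psi_submul.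
Qed.

Lemma theta_ge_half J : 2^-1 <= theta J.
Proof.
rewrite /theta ler_pdivlMr ?Psi_gt0//.
suff : Psi J <= 2 * 4 ^+ J - 1 by lra.
elim: J => [|J IH]; first by rewrite Psi0 expr0; lra.
rewrite PsiS exprS; have P := Psi_gt0 J.
suff : g * Psi J <= 1 * Psi J by lra.
by rewrite ler_pM2r// ltW.
Qed.

(** Unboundedness in qualitative form suffices: supermultiplicativity turns a
single value above 1 into geometric growth.  Were theta bounded by 4, the
recursion 1/theta (J+1) = 4^-(J+1) + g / theta J would lower 1/theta by a fixed
amount at every step. *)
Lemma theta_large : exists2 j0, (0 < j0)%N & 4 <= theta j0.
Proof.
suff [j0 H] : exists j0, 4 <= theta j0.
  by exists j0 => //; case: j0 H => //; rewrite theta0; lra.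
apply: contrapT => /forallNP H.
have H' j : 4^-1 < (theta j)^-1.
  by rewrite ltf_pV2 ?posrE ?theta_gt0// ltNge; apply/negP/H.
have S j : (theta j.+1)^-1 = 4^-1 ^+ j.+1 + g * (theta j)^-1.
  rewrite /theta !invf_div PsiS exprVn exprS; have := Psi_gt0 j.
  have : (0 : R) < 4 ^+ j by rewrite exprn_gt0.
  by move=> h1 h2; field; rewrite !gt_eqF.
(* The term 4^-j telescopes the sum of the inhomogeneous terms. *)
have B j : (theta j)^-1 <= 2 - 4^-1 ^+ j - j%:R * ((1 - g) / 4).
  elim: j => [|j IH]; first by rewrite theta0 expr0 invr1; lra.
  rewrite S -[j.+1%:R]natr1 exprS.
  have : (0 : R) <= 4^-1 ^+ j by rewrite exprn_ge0// invr_ge0.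
  have : (1 - g) * 4^-1 <= (1 - g) * (theta j)^-1.
    by rewrite ler_pM2l ?subr_gt0// ltW.
  move: (4^-1 ^+ j) (theta j)^-1 (j%:R) IH => x y z; lra.
have g1 : 0 < (1 - g) / 4 by rewrite divr_gt0// subr_gt0.
pose N := (Num.truncn (2 / ((1 - g) / 4))).+1.
have := B N; have : 2 / ((1 - g) / 4) < N%:R by rewrite /N truncnS_gt.
rewrite ltr_pdivrMr// => h1 h2.
have h3 : (0 : R) <= 4^-1 ^+ N by rewrite exprn_ge0// invr_ge0.
have := H' N; lra.
Qed.

Lemma theta_pow (j0 : nat) k : 4 <= theta j0 -> 4 ^+ k <= theta (k * j0).
Proof.
move=> h; elim: k => [|k IH]; first by rewrite expr0 theta0.
rewrite mulSn; apply: le_trans (theta_supmul _ _); rewrite exprS.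
by apply: ler_pM => //; exact: exprn_ge0.
Qed.

(** A polynomial comparison of space with time; the exponent q is not optimal,
and the Chernoff bound below is strong enough to absorb any q. *)
Lemma pow_le_theta (d : nat) : exists (q : nat) (C : R), 0 < C /\
  forall k, (2 ^+ d) ^+ k <= C * theta k ^+ q.
Proof.
have [j0 j0p h] := theta_large; exists (d * j0)%N, (4 ^+ (d * j0)).
split; first by rewrite exprn_gt0.
move=> k; set q := (d * j0)%N.
pose m := (k %/ j0)%N.
have h1 : 4 ^+ m / 2 <= theta k.
  rewrite (divn_eq k j0) -/m; apply: le_trans (theta_supmul _ _).
  apply: ler_pM => //; last exact: theta_ge_half.
  exact: theta_pow.
apply: (@le_trans _ _ (4 ^+ q * (4 ^+ m / 2) ^+ q)); last first.
  apply: ler_wpM2l; first exact: exprn_ge0.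
  apply: lerXn2r h1; rewrite nnegrE; last exact: ltW (theta_gt0 _).
  by rewrite divr_ge0 ?exprn_ge0.
rewrite -exprMn [X in X ^+ q](_ : _ = 2 * 4 ^+ m); last by field.
apply: (@le_trans _ _ ((2 * 2 ^+ m) ^+ q)); last first.
  have h4 : (2 : R) ^+ m <= 4 ^+ m by apply: lerXn2r; rewrite ?nnegrE//; lra.
  by apply: lerXn2r; rewrite ?nnegrE ?ler_pM2l// mulr_ge0// exprn_ge0.
rewrite -exprS -!exprM ler_weXn2l ?ler1n// /q /m.
rewrite mulnCA leq_mul2l; apply/orP; right.
exact: ltnW (ltn_ceil k j0p).
Qed.

(** A discrete inverse of theta, truncated at J. *)
Lemma theta_index J (X : R) : exists i, [/\ (i <= J)%N,
  i = 0%N \/ theta i <= X & i = J \/ X < theta i.+1].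
Proof.
elim: J => [|J [i [iJ h1 h2]]]; first by exists 0%N; split; [|left|left].
have [h|h] := leP (theta J.+1) X; first by exists J.+1; split; [|right|left].
by exists i; split=> //; [exact: leq_trans iJ _|case: h2 => [->|]; right].
Qed.

(** The sum that bounds the contribution of large times to the Green function.
Consecutive terms have ratio at most min(4, 1/g) / 2^d, which is
2^(min(alpha, 2) - d). *)
Lemma theta_decay (d : nat) : 4 < 2 ^+ d :> R \/ g^-1 < 2 ^+ d ->
  exists C : R, 0 < C /\ forall J I,
    \sum_(J <= i < I) theta i.+1 / (2 ^+ d) ^+ i <= C * (theta J / (2 ^+ d) ^+ J).
Proof.
move=> H; have [m [m1 mg]] : exists m : R, 0 < m < 2 ^+ d /\ forall i, theta i.+1 <=
  m * theta i.
  case: H => H; first by exists 4; split=> [|i]; [rewrite H ltr0n|exact: theta_le4].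
  by exists g^-1; split=> [|i]; [rewrite H invr_gt0 g_gt0|exact: theta_leg].
case/andP: m1 => m0 m2; set D := 2 ^+ d in H m2 *.
have D0 : 0 < D by rewrite exprn_gt0.
exists (m / (1 - m / D)); have r1 : 0 < 1 - m / D by rewrite subr_gt0 ltr_pdivrMr// mul1r.
split=> [|J I]; first by rewrite divr_gt0.
have E k : theta (J + k) / D ^+ (J + k) <= (m / D) ^+ k * (theta J / D ^+ J).
  elim: k => [|k IH]; first by rewrite addn0 expr0 mul1r.
  rewrite addnS !exprS; apply: (@le_trans _ _ (m / D * (theta (J + k) / D ^+ (J + k)))).
    rewrite invfM [leRHS]mulrACA; apply: ler_wpM2r; last exact: mg.
    by apply: mulr_ge0; rewrite invr_ge0 ?exprn_ge0// ltW.
  by rewrite -[leRHS]mulrA ler_wpM2l// divr_ge0 ?ltW.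
have T0 : 0 <= theta J / D ^+ J by apply: divr_ge0;
  [exact: ltW (theta_gt0 _)|exact/exprn_ge0/ltW].
have [IJ|JI] := leqP I J.
  by rewrite big_geq// mulr_ge0// divr_ge0// ltW.
rewrite -(subnKC (ltnW JI)); move: (I - J)%N => n {I JI}.
suff : (1 - m / D) * \sum_(J <= i < J + n) theta i.+1 / D ^+ i <=
   m * (theta J / D ^+ J) * (1 - (m / D) ^+ n).
  move=> S; rewrite mulrAC ler_pdivlMr// mulrC (le_trans S)//.
  apply: ler_piMr; first exact: mulr_ge0 (ltW m0) T0.
  by rewrite gerBl; apply: exprn_ge0; rewrite divr_ge0 ?ltW.
elim: n => [|n IH]; first by rewrite addn0 big_geq// expr0 subrr !mulr0.
rewrite addnS big_nat_recr ?leq_addr//= mulrDr.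
set w := theta J / D ^+ J; rewrite -/w in IH E T0.
have : theta (J + n).+1 / D ^+ (J + n) <= m * ((m / D) ^+ n * w).
  apply: le_trans (_ : m * (theta (J + n) / D ^+ (J + n)) <= _).
    by rewrite mulrA ler_wpM2r ?mg// invr_ge0 exprn_ge0// ltW.
  by rewrite ler_wpM2l// ltW.
rewrite -(ler_pM2l r1) => h; apply: le_trans (lerD IH h) _.
apply: eq_ler; rewrite exprS; ring.
Qed.

End Theta.

(** * Dyadic kernels and their two-step lower bound *)

(** Only the terms with q^j <= B survive, and they decrease geometrically from
a first one which is at most B. *)
Lemma geo_sum (R : realType) (q B : R) n : 0 < q <= 2^-1 -> 0 <= B ->
  \sum_(j < n) q ^+ j * (q ^+ j <= B)%R%:R <= 2 * B.
Proof.
move=> /andP[q0 q1]; elim: n B => [|n IH] B B0; first by rewrite big_ord0 mulr_ge0.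
have [B1|B1] := leP 1 B.
  have [H1 H2] : \sum_(j < n.+1) q ^+ j <= 2 - q ^+ n /\ 0 <= q ^+ n.
    elim: n {IH} => [|n [IH IH2]]; first by rewrite big_ord1 !expr0; lra.
    by rewrite big_ord_recr/= exprS; split; [|apply: mulr_ge0; lra];
      have : q * q ^+ n <= 2^-1 * q ^+ n; [rewrite ler_wpM2r|lra].
  apply: (@le_trans _ _ (\sum_(j < n.+1) q ^+ j)); last by lra.
  apply: ler_sum => j _; rewrite ler_piMr ?exprn_ge0 ?(ltW q0)//.
  by case: (_ <= B).
rewrite big_ord_recl expr0 mul1r [1 <= B]leNgt B1/= add0r.
apply: (@le_trans _ _ (q * \sum_(j < n) q ^+ j * (q ^+ j <= B / q)%R%:R)).
  rewrite mulr_sumr; apply: ler_sum => j _.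
  by rewrite /bump/= exprS ler_pdivlMr// [q ^+ j * q]mulrC mulrA.
apply: (@le_trans _ _ (q * (2 * (B / q)))).
  by rewrite ler_pM2l// IH// divr_ge0// ltW.
by apply: eq_ler; field; rewrite gt_eqF.
Qed.

Lemma expn_superadd a b n : (0 < n)%N -> (a ^ n + b ^ n <= (a + b) ^ n)%N.
Proof.
case: n => // n _; elim: n => [|n IH]; first by rewrite !expn1.
rewrite !(expnS _ n.+1) mulnDl; apply: leq_add.
  by rewrite leq_mul2l; apply/orP; right; rewrite (leq_trans _ IH)// leq_addr.
by rewrite leq_mul2l; apply/orP; right; rewrite (leq_trans _ IH)// leq_addl.
Qed.

Lemma size_rem_ge (T : eqType) (x : T) s : ((size s).-1 <= size (rem x s))%N.
Proof.
by have [xs|xs] := boolP (x \in s); [rewrite size_rem|rewrite rem_id// leq_pred].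
Qed.

(** What the argument uses of the step distribution: D(x) is comparable to
l^-d (max(|x|, l) / l)^-(d + alpha), stated at the dyadic distances 2^j l with
g = 2^-alpha. *)
Record dyadic_kernel (R : realType) (d : nat) (g c K : R) (l : nat) (D : 'rV[int]_d ->
  R) : Prop := DyadicKernel {
  dk_scale_gt0 : (0 < l)%N;
  dk_summ : summ D;
  dk_tsum : tsum D = 1;
  dk_even : forall x, D (- x) = D x;
  dk_0 : D 0 = 0;
  dk_lower : forall x j, x != 0 -> (supnorm x <= 2 ^ j * l)%N ->
    c * (g / 2 ^+ d) ^+ j / l%:R ^+ d <= D x;
  dk_upper : forall x j, (2 ^ j * l < supnorm x)%N -> D x <= K * (g / 2 ^+ d) ^+ j / l%:R ^+ d;
  dk_sup : forall x, D x <= K / l%:R ^+ d }.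

Section Ondiag.
Variables (R : realType) (d : nat) (g c K : R).
Hypotheses (d_gt0 : (0 < d)%N) (g_gt0 : 0 < g) (g_lt1 : g < 1) (c_gt0 : 0 < c) (K_gt0 : 0 < K).
Local Notation V := 'rV[int]_d.
Local Notation th := (theta g).
Let q : R := g / 2 ^+ d.

Let q_gt0 : 0 < q. Proof. by rewrite divr_gt0 ?exprn_gt0. Qed.
Let q_le : q <= 2^-1.
Proof.
rewrite /q ler_pdivrMr ?exprn_gt0//; apply: (le_trans (ltW g_lt1)).
rewrite mulrC ler_pdivlMr// mul1r -[leLHS]expr1 ler_weXn2l// ler1n//.
Qed.

Section Fixed.
Variables (l : nat) (D : V -> R).
Hypothesis W : dyadic_kernel g c K l D.
Let lam : R := (l%:R ^+ d)^-1.
Let l_gt0 := dk_scale_gt0 W.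
Let Ds := dk_summ W.

Let ld_gt0 : 0 < l%:R ^+ d :> R. Proof. by rewrite exprn_gt0// ltr0n. Qed.
Let lam_gt0 : 0 < lam. Proof. by rewrite invr_gt0. Qed.

Lemma dk_pow_summ n : summ (cpow D n). Proof. by case: (cpow_summ n Ds). Qed.
Lemma dk_pow_tsum n : tsum (cpow D n) = 1.
Proof. by case: (cpow_summ n Ds) => _ ->; rewrite (dk_tsum W) expr1n. Qed.
Lemma dk_pow_ge0 n x : 0 <= cpow D n x. Proof. exact: summ_ge0 (dk_pow_summ n). Qed.
Lemma dk_pow_even n x : cpow D n (- x) = cpow D n x.
Proof. exact: cpow_even Ds (dk_even W) x. Qed.

Lemma dk_pow_sup n x : cpow D n.+1 x <= K * lam.
Proof.
rewrite -(addn1 n) cpowD// (cpow1 Ds) -[leRHS]mul1r -(dk_pow_tsum n).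
by apply: convol_sup (dk_pow_summ n) _ => y; rewrite (summ_ge0 y Ds) (dk_sup W).
Qed.

(** The first step ranges over the cube of radius l, with 0 and z removed
because the lower bound on D fails at 0; enough points remain since d >= 1.
Two steps also give a lower bound at z = 0. *)
Lemma two_step_lower z j : (supnorm z <= 2 ^ j * l)%N ->
  c ^+ 2 * q * q ^+ j * lam <= cpow D 2 z.
Proof.
move=> zj; rewrite cpowS (cpow1 Ds).
(* The w such that D is bounded below at both w and z - w. *)
pose s := rem z (rem 0 (cube d l)).
have s_uniq : uniq s by rewrite !rem_uniq// cube_uniq.
have memS w : w \in s -> [/\ w != 0, w != z & (supnorm w <= l)%N].
  rewrite /s mem_rem_uniq ?rem_uniq ?cube_uniq// inE => /andP[h1].
  by rewrite mem_rem_uniq ?cube_uniq// inE => /andP[h2]; rewrite mem_cube.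
(* (2l + 1)^d >= l^d + (l + 1)^d, and the last term is at least 2. *)
have szS : (l ^ d <= size s)%N.
  have h := expn_superadd l l.+1 d_gt0.
  have h2 : (2 <= l.+1 ^ d)%N by apply: leq_trans (_ : l.+1 ^ 1 <= _)%N;
    [rewrite expn1 ltnS|rewrite leq_pexp2l].
  have h3 : ((size (cube d l)).-2 <= size s)%N.
    apply: leq_trans (size_rem_ge _ _); rewrite -[_.-2]/(_.-1.-1) -!(subn1 _.-1) -(subn1
      (size (rem _ _))).
    by rewrite leq_sub2r// size_rem_ge.
  by apply: leq_trans h3; rewrite size_cube mul2n -addnn -addnS; lia.
apply: le_trans (tsum_fset_le s_uniq (convol_term_summ z Ds Ds)).
apply: (@le_trans _ _ (\sum_(w <- s) (c * lam) * (c * q ^+ j.+1 * lam))).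
  rewrite big_const_seq count_predT iter_addr_0 -mulr_natl.
  apply: (@le_trans _ _ (l%:R ^+ d * (c * lam * (c * q ^+ j.+1 * lam)))).
    rewrite /lam (exprS q); apply: eq_ler.
    by field; rewrite gt_eqF.
  rewrite ler_wpM2r//; last by rewrite -natrX ler_nat.
  by rewrite !mulr_ge0 ?exprn_ge0// ltW.
rewrite big_seq [leRHS]big_seq; apply: ler_sum => w /memS[w0 wz wl].
apply: ler_pM.
- by rewrite mulr_ge0// ltW.
- by rewrite !mulr_ge0 ?exprn_ge0// ltW.
- by have := @dk_lower _ _ _ _ _ _ _ W w 0 w0; rewrite mul1n expr0 mulr1; apply.
- apply: (@dk_lower _ _ _ _ _ _ _ W); first by rewrite subr_eq0 eq_sym.
  apply: leq_trans (supnormD _ _) _; rewrite supnormN expnS.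
  have : (l <= 2 ^ j * l)%N by rewrite leq_pmull// expn_gt0.
  by move: zj wl; rewrite -mulnA; lia.
Qed.

(** At z the cube indicators vanish up to the scale of z, after which the
weights q^j decrease geometrically; so the sum is comparable to its first
nonzero term, which two_step_lower bounds. *)
Lemma two_step_ge_cubes z J : c ^+ 2 * q ^+ 2 / 2 * lam *
  \sum_(j < J) q ^+ j * (supnorm z <= 2 ^ j.+1 * l)%N%:R <= cpow D 2 z.
Proof.
pose B := cpow D 2 z / (c ^+ 2 * q ^+ 2 * lam).
have A0 : 0 < c ^+ 2 * q ^+ 2 * lam by rewrite !mulr_gt0 ?exprn_gt0.
have B0 : 0 <= B by rewrite divr_ge0 ?dk_pow_ge0// ltW.
apply: (@le_trans _ _ (c ^+ 2 * q ^+ 2 / 2 * lam * (2 * B))); last first.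
  rewrite /B; apply: eq_ler; field.
  by rewrite !gt_eqF.
rewrite ler_pM2l; last by rewrite !mulr_gt0 ?exprn_gt0.
apply: (le_trans _ (@geo_sum _ q B J _ B0)); last by rewrite q_gt0 q_le.
apply: ler_sum => j _; rewrite ler_wpM2l ?exprn_ge0 ?(ltW q_gt0)//.
case: leqP => [h|_]; last by rewrite ler0n.
suff -> : q ^+ j <= B by [].
rewrite /B ler_pdivlMr//.
by have := two_step_lower h; rewrite (exprS q) => h'; apply: le_trans h'; apply: eq_ler; ring.
Qed.

End Fixed.
End Ondiag.

(** * The Nash inequality *)

Section Nash.
Variables (R : realType) (d : nat) (g c K : R).
Hypotheses (d_gt0 : (0 < d)%N) (g_gt0 : 0 < g) (g_lt1 : g < 1) (c_gt0 : 0 < c) (K_gt0 : 0 < K).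
Local Notation V := 'rV[int]_d.
Local Notation th := (theta g).
Let q : R := g / 2 ^+ d.
Let q_gt0 : 0 < q. Proof. by rewrite divr_gt0 ?exprn_gt0. Qed.

Definition nash_const : R := c ^+ 2 * q ^+ 2 / 8.
Lemma nash_const_gt0 : 0 < nash_const. Proof. by rewrite !mulr_gt0 ?exprn_gt0. Qed.

(** On the scale 2^j l, the sum of e over a cube controls e on that scale by
cube_avg, hence e(y) at the larger scale 2^J l at the cost of 4^(J - j) by
double_energy.  Weighted by the kernel at that scale, the contribution is
proportional to 4^-J (4g)^j e(y), and the contributions of all j <= J add up
because the cubes are superposed in two_step_ge_cubes: the total is
4^-J Psi J e(y) = e(y) / theta J. *)
Lemma energy_lower l (D : V -> R) (e : V -> R) J y : dyadic_kernel g c K l D ->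
  (forall y, 0 <= e y) -> (forall y, e (- y) = e y) ->
  (forall y z, e (y + z) <= 2 * e y + 2 * e z) ->
  summ (fun z => cpow D 2 z * e z) ->
  (supnorm y <= 2 ^ J * l)%N -> nash_const * e y <= th J * tsum (fun z => cpow D 2 z * e z).
Proof.
move=> W e0 eN eD es yJ; set E := tsum _.
have l0 := dk_scale_gt0 W.
have ld : 0 < l%:R ^+ d :> R by rewrite exprn_gt0// ltr0n.
pose A := c ^+ 2 * q ^+ 2 / 2 * (l%:R ^+ d)^-1.
have A0 : 0 < A by rewrite !mulr_gt0 ?exprn_gt0 ?invr_gt0.
pose S := cube d (2 ^ J.+1 * l).
pose T j := \sum_(z <- cube d (2 * (2 ^ j * l))) e z.
have T1 (j : 'I_J.+1) : e y * ((2 ^+ d) ^+ j * l%:R ^+ d / (4 * 4 ^+ (J - j))) <= T j.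
  pose n := (2 ^ j * l)%N; pose m : R := ((2 * n).+1 ^ d)%:R.
  have m0 : 0 < m by rewrite /m ltr0n expn_gt0.
  have eB w : (supnorm w <= n)%N -> e w <= 4 * T j / m.
    by move=> wn; rewrite ler_pdivlMr// mulrC; apply: cube_avg.
  have := @double_energy d R e n (4 * T j / m) (J - j) eD eB y.
  rewrite /n mulnA -expnD subnK; last by rewrite -ltnS ltn_ord.
  move=> /(_ yJ) h.
  have n4 : 0 < 4 * 4 ^+ (J - j) :> R by rewrite mulr_gt0 ?exprn_gt0.
  rewrite mulrA ler_pdivrMr// -[leRHS](mulrC (4 * 4 ^+ (J - j))).
  apply: (@le_trans _ _ (e y * m)); last first.
    rewrite -ler_pdivlMr//; apply: le_trans h _.
    by apply: eq_ler; ring.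
  rewrite ler_wpM2l// -exprM mulnC exprM -exprMn /m natrX lerXn2r ?nnegrE ?mulr_ge0
    ?exprn_ge0 ?ler0n//.
  by rewrite -natrX -natrM ler_nat /n; lia.
have H1 : \sum_(z <- S) cpow D 2 z * e z <= E by apply: tsum_fset_le; rewrite ?cube_uniq.
(* The cube of scale j + 1 is where the j-th weight of two_step_ge_cubes
   lives, and is contained in the largest cube S. *)
have H2 : \sum_(j < J.+1) q ^+ j * T j <=
    \sum_(z <- S) (\sum_(j < J.+1) q ^+ j * (supnorm z <= 2 ^ j.+1 * l)%N%:R) * e z.
  under [leRHS]eq_bigr do rewrite mulr_suml.
  rewrite exchange_big/=; apply: ler_sum => j _.
  under [leRHS]eq_bigr do rewrite -mulrA.
  rewrite -mulr_sumr; apply: ler_wpM2l; first by rewrite exprn_ge0// ltW.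
  apply: (@le_trans _ _ (\sum_(z <- cube d (2 * (2 ^ j * l))) (supnorm z <=
    2 ^ j.+1 * l)%N%:R * e z)).
    rewrite /T big_seq [leRHS]big_seq; apply: ler_sum => z.
    by rewrite mem_cube mulnA -expnS => ->; rewrite mul1r.
  apply: sum_subseq; rewrite ?cube_uniq//; last by move=> z; rewrite mulr_ge0.
  move=> z; rewrite !mem_cube mulnA -expnS => /leq_trans; apply.
  by rewrite leq_mul2r leq_pexp2l ?orbT// ltn_ord.
have H3 : A * (\sum_(z <- S) (\sum_(j < J.+1) q ^+ j * (supnorm z <=
  2 ^ j.+1 * l)%N%:R) * e z) <= \sum_(z <- S) cpow D 2 z * e z.
  rewrite mulr_sumr; apply: ler_sum => z _; rewrite mulrA; apply: ler_wpM2r => //.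
  exact: two_step_ge_cubes W _ _.
have H4 : e y * (l%:R ^+ d / 4 * (th J)^-1) <= \sum_(j < J.+1) q ^+ j * T j.
  rewrite /theta invf_div /Psi mulr_suml !mulr_sumr; apply: ler_sum => j _.
  apply: (@le_trans _ _ (q ^+ j * (e y * ((2 ^+ d) ^+ j * l%:R ^+ d / (4 * 4 ^+ (J -
    j)))))); last first.
    by rewrite ler_wpM2l ?exprn_ge0 ?(ltW q_gt0).
  apply: eq_ler.
  have jJ : (j <= J)%N by rewrite -ltnS ltn_ord.
  rewrite -[in 4 ^+ J](subnK jJ) exprD /q !exprMn exprVn; field.
  by rewrite !expf_neq0.
rewrite [leRHS]mulrC -ler_pdivrMr ?theta_gt0//.
apply: le_trans H1; apply: le_trans H3.
apply: (@le_trans _ _ (A * (e y * (l%:R ^+ d / 4 * (th J)^-1)))).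
  rewrite /nash_const /A; apply: eq_ler; field.
  by rewrite !gt_eqF ?theta_gt0.
by rewrite ler_pM2l//; apply: le_trans H2.
Qed.

Section Fixed.
Variables (l : nat) (D : V -> R).
Hypothesis W : dyadic_kernel g c K l D.
Let lam : R := (l%:R ^+ d)^-1.
Let l_gt0 := dk_scale_gt0 W.
Let Ds := dk_summ W.
Let ld_gt0 : 0 < l%:R ^+ d :> R. Proof. by rewrite exprn_gt0// ltr0n. Qed.
Let lam_gt0 : 0 < lam. Proof. by rewrite invr_gt0. Qed.

(** At even times only: the walk is symmetric, so p_2n(0) is the square of
an l^2 norm and dominates p_2n. *)
Definition return_prob n : R := cpow D (n + n) 0.

Lemma even_time_max n x : cpow D (n + n) x <= return_prob n.
Proof.
rewrite /return_prob cpowD//; apply: energy_ge0; first exact: (dk_pow_summ W).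
exact: (dk_pow_even W).
Qed.

Lemma return_prob_ge0 n : 0 <= return_prob n. Proof. exact: (dk_pow_ge0 W). Qed.

(** Two more steps average p_2n with the weights p_2. *)
Lemma return_prob_drop n : let e := fun z => return_prob n - cpow D (n + n) z in
  summ (fun z => cpow D 2 z * e z) /\ tsum (fun z =>
    cpow D 2 z * e z) = return_prob n - return_prob n.+1.
Proof.
move=> e; have p2s := dk_pow_summ W 2; have pns := dk_pow_summ W (n + n).
have [s1 e1] := tsumZr (return_prob_ge0 n) p2s.
rewrite (dk_pow_tsum W) mul1r in e1.
have E0 : (fun z => cpow D 2 z * cpow D (n + n) (0 - z)) =
    (fun z => cpow D 2 z * cpow D (n + n) z).
  apply/funext => z; by rewrite sub0r (dk_pow_even W (n + n) z).
have := convol_term_summ 0 p2s pns; rewrite E0 => s2.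
have e2 : tsum (fun z => cpow D 2 z * cpow D (n + n) z) = return_prob n.+1.
  rewrite /return_prob addnS addSn -[(n + n).+2]/(2 + (n + n))%N (cpowD 2 (n + n) Ds).
  by rewrite /convol; congr tsum; apply/funext => z; rewrite sub0r (dk_pow_even W (n + n) z).
have [|s3 e3] := tsumB s1 (g := fun z => cpow D 2 z * cpow D (n + n) z).
  move=> z; apply/andP; split; first exact: mulr_ge0 (dk_pow_ge0 W _ _) (dk_pow_ge0 W _ _).
  exact: ler_wpM2l (dk_pow_ge0 W _ _) _ _ (even_time_max _ _).
have E : (fun z => cpow D 2 z * e z) =
   (fun z => cpow D 2 z * return_prob n - cpow D 2 z * cpow D (n + n) z).
  by apply/funext => z; rewrite /e mulrBr.
by rewrite E e3 e1 e2.
Qed.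

Lemma return_prob_dec n : return_prob n.+1 <= return_prob n.
Proof.
rewrite -subr_ge0; have [_ <-] := return_prob_drop n; apply: tsum_ge0 => z.
apply: mulr_ge0; first exact: (dk_pow_ge0 W).
rewrite subr_ge0; exact: even_time_max.
Qed.

Lemma return_prob_nincr m n : (m <= n)%N -> return_prob n <= return_prob m.
Proof.
move=> /subnK <-; elim: (n - m)%N => [//|k IH]; rewrite addSn.
exact: le_trans (return_prob_dec _) IH.
Qed.

(** The return probability is the average over a cube of p_2n plus the
average of e; the former is at most 1 / (size of the cube), the latter is
controlled by energy_lower. *)
Lemma nash_inequality n J : return_prob n <=
  lam / (2 ^+ d) ^+ J + th J / nash_const * (return_prob n - return_prob n.+1).
Proof.
pose e := fun z => return_prob n - cpow D (n + n) z.
have pns := dk_pow_summ W n; have pne := dk_pow_even W n.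
have eE z : e z = convol (cpow D n) (cpow D n) 0 - convol (cpow D n) (cpow D n) z.
  by rewrite /e /return_prob cpowD.
have e0 z : 0 <= e z by rewrite subr_ge0; exact: even_time_max.
have [es eT] := return_prob_drop n.
have H y : (supnorm y <= 2 ^ J * l)%N ->
  e y <= th J / nash_const * (return_prob n - return_prob n.+1).
  move=> yJ; rewrite mulrAC ler_pdivlMr ?nash_const_gt0// mulrC -eT.
  apply: (energy_lower W) => //.
  - by move=> z; rewrite /e (dk_pow_even W (n + n) z).
  - by move=> a b; rewrite !eE; apply: energyD.
set X := th J / nash_const * _ in H *.
pose Q := cube d (2 ^ J * l).
have hN := nash_avg (cube_uniq d (2 ^ J * l)) pns.
rewrite (dk_pow_tsum W) expr1n in hN.
pose m : R := (size Q)%:R.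
have m1 : (2 ^+ d) ^+ J * l%:R ^+ d <= m.
  rewrite /m size_cube natrX -exprM mulnC exprM -exprMn lerXn2r ?nnegrE ?mulr_ge0
    ?exprn_ge0 ?ler0n//.
  by rewrite -natrX -natrM ler_nat; lia.
have m0 : 0 < m by apply: lt_le_trans m1; rewrite mulr_gt0 ?exprn_gt0// ltr0n.
have hm : m * return_prob n <= m * X + 1.
  have -> : m * return_prob n = \sum_(z <- Q) (e z + convol (cpow D n) (cpow D n) z).
    transitivity (\sum_(z <- Q) return_prob n).
      by rewrite big_const_seq count_predT iter_addr_0 mulr_natl.
    by apply: eq_bigr => z _; rewrite /e cpowD// subrK.
  rewrite big_split/= lerD//.
  apply: (@le_trans _ _ (\sum_(z <- Q) X)).
    by rewrite big_seq [leRHS]big_seq; apply: ler_sum => z; rewrite mem_cube => /H.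
  by rewrite big_const_seq count_predT iter_addr_0 mulr_natl.
rewrite addrC -(ler_pM2l m0) mulrDr; apply: le_trans hm _; rewrite lerD2l.
rewrite /lam -invfM ler_pdivlMr; first by rewrite mul1r mulrC.
by rewrite mulr_gt0 ?exprn_gt0// ltr0n.
Qed.

(** Sum nash_inequality over n steps; the sum telescopes and the return
probability is monotone. *)
Lemma return_prob_double n J : (0 < n)%N ->
  return_prob (n + n) <= lam / (2 ^+ d) ^+ J + th J / nash_const / n%:R * return_prob n.
Proof.
move=> n0; have nR : 0 < n%:R :> R by rewrite ltr0n.
have T0 : 0 <= th J / nash_const by rewrite divr_ge0// ltW ?nash_const_gt0// theta_gt0.
have S k : k%:R * return_prob (n + k) <=
  k%:R * (lam / (2 ^+ d) ^+ J) + th J / nash_const * (return_prob n - return_prob (n + k)).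
  elim: k => [|k IH]; first by rewrite !mul0r addn0 subrr mulr0 addr0.
  have h1 := nash_inequality (n + k) J; have h2 := return_prob_dec (n + k).
  have h3 : k%:R * return_prob (n + k).+1 <= k%:R * return_prob (n + k) by rewrite ler_wpM2l.
  rewrite addnS -natr1 !mulrDl !mul1r; set X := lam / _ in h1 IH *.
  move: (th J / nash_const) T0 h1 IH => t t0 h1 IH.
  lra.
have := S n; rewrite -(ler_pM2l nR) => _.
have h : n%:R * return_prob (n + n) <= n%:R * (lam / (2 ^+ d) ^+ J) + th J / nash_const *
  return_prob n.
  apply: le_trans (S n) _; rewrite lerD2l ler_wpM2l// gerBl; exact: return_prob_ge0.
rewrite -(ler_pM2l nR); apply: le_trans h _.
rewrite mulrDr lerD2l; apply: eq_ler; field.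
by rewrite !gt_eqF// nash_const_gt0.
Qed.

Lemma return_prob_sup n : (0 < n)%N -> return_prob n <= K * lam.
Proof. by case: n => // n _; rewrite /return_prob addSn; apply: (dk_pow_sup W). Qed.

Lemma dk_pow_le_return_prob n x : (1 < n)%N -> cpow D n x <= return_prob n./2.
Proof.
move=> n1; rewrite -{1}(odd_double_half n) -addnn; case: (odd n); rewrite ?add0n ?add1n.
  rewrite cpowS -[leRHS]mul1r -(dk_tsum W).
  by apply: convol_sup Ds _ => y; apply/andP; split;
    [exact: (dk_pow_ge0 W)|exact: even_time_max].
exact: even_time_max.
Qed.

End Fixed.
End Nash.

(** * Decay of the heat kernel in time *)

Lemma half_third (R : realType) n : (1 < n)%N -> n%:R <= 3 * n./2%:R :> R.
Proof. by move=> n1; rewrite -natrM ler_nat; lia. Qed.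

Lemma half_third_up (R : realType) n : (1 < n)%N -> n%:R <= 3 * (n - n./2)%N%:R :> R.
Proof. by move=> n1; rewrite -natrM ler_nat; lia. Qed.

Section Decay.
Variables (R : realType) (d : nat) (g c K : R).
Hypotheses (d_gt0 : (0 < d)%N) (g_gt0 : 0 < g) (g_lt1 : g < 1) (c_gt0 : 0 < c) (K_gt0 : 0 < K).
Local Notation V := 'rV[int]_d.
Local Notation th := (theta g).
Let P (J : nat) : R := (2 ^+ d) ^+ J.
Let P_gt0 J : 0 < P J. Proof. by rewrite !exprn_gt0. Qed.
Let P_le i j : (i <= j)%N -> P i <= P j.
Proof. by move=> ij; rewrite ler_weXn2l// exprn_ege1// ler1n. Qed.
Let P_split i j : (j <= i)%N -> P i = P j * P (i - j).
Proof. by move=> ij; rewrite /P -exprD subnKC. Qed.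


(** Induction on the scale, from J - j0 to J: theta grows at least by the
factor 4 over j0 scales, which leaves room to halve n.  If k is large, the
second term of return_prob_double absorbs the loss 2^(d j0) of the induction
hypothesis. *)
Lemma return_prob_decay : exists (C k : R), [/\ 0 < C, 1 <= k &
  forall l (D : V -> R), dyadic_kernel g c K l D -> forall J n, (0 < n)%N ->
    k * th J <= n%:R -> return_prob D n <= C * (l%:R ^+ d)^-1 / P J].
Proof.
have [j0 j0_gt0 hj0] := theta_large g_gt0 g_lt1.
have kp : 0 < nash_const d g c by exact: nash_const_gt0.
set ka := nash_const d g c in kp.
pose M := P j0; have M0 : 0 < M by exact: P_gt0.
pose k := 1 + 6 * M / ka; pose C := 2 + K * M.
have k1 : 1 <= k by rewrite lerDl divr_ge0 ?mulr_ge0 ?ltW.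
have C0 : 2 <= C by rewrite lerDl mulr_ge0 ?ltW.
exists C, k; split=> //; first exact: lt_le_trans C0.
move=> l D W; have l0 := dk_scale_gt0 W.
set lam := (l%:R ^+ d)^-1; have lam0 : 0 < lam by rewrite invr_gt0 exprn_gt0// ltr0n.
elim/ltn_ind => J IH n n0 hn.
have [Jj|jJ] := ltnP J j0.
  apply: le_trans (return_prob_sup W n0) _; rewrite ler_pdivlMr//.
  have h := P_le (ltnW Jj); rewrite mulrAC; apply: ler_wpM2r; first exact: ltW.
  by apply: (@le_trans _ _ (K * M)); [rewrite ler_pM2l|rewrite lerDr].
pose i := (J - j0)%N.
have iJ : (i < J)%N by rewrite /i ltn_subrL j0_gt0 (leq_trans j0_gt0 jJ).
have thJ : 4 * th i <= th J.
  rewrite -(subnKC jJ); apply: le_trans (theta_supmul g_gt0 _ _).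
  by rewrite ler_wpM2r// ltW// theta_gt0.
have thi := theta_ge_half g_gt0 g_lt1 i.
have hn' : th J <= n%:R.
  apply: le_trans hn; rewrite ler_peMl// ltW// theta_gt0//.
have n2 : (1 < n)%N by rewrite -(ltr_nat R); lra.
pose m := n./2.
have m0 : (0 < m)%N by rewrite half_gt0.
have mR : 0 < m%:R :> R by rewrite ltr0n.
have n3 := half_third R n2; rewrite -/m in n3.
have hk : k * th J <= 3 * m%:R by apply: le_trans hn n3.
have IHm : return_prob D m <= C * lam / P i.
  apply: IH => //.
  have : k * (4 * th i) <= k * th J by rewrite ler_wpM2l// (le_trans _ k1).
  by move: hk mR; rewrite mulrCA; lra.
have hu : return_prob D n <= return_prob D (m + m) by apply: (return_prob_nincr W);
  rewrite /m addnn -{2}(odd_double_half n) leq_addl.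
apply: le_trans hu _.
apply: le_trans (return_prob_double d_gt0 g_gt0 g_lt1 c_gt0 K_gt0 W J m0) _.
rewrite -/lam -/ka -/(P J).
have t1 : th J / ka / m%:R <= 3 / (k * ka).
  have k0 : 0 < k by apply: lt_le_trans k1.
  rewrite ler_pdivrMr// ler_pdivrMr//.
  have -> : 3 / (k * ka) * m%:R * ka = 3 * m%:R / k by field; rewrite !gt_eqF.
  by rewrite ler_pdivlMr// mulrC.
(* This is what the choice of k is for. *)
have t2 : 3 / (k * ka) * M <= 2^-1.
  have k0 : 0 < k by apply: lt_le_trans k1.
  rewrite mulrAC ler_pdivrMr ?mulr_gt0//.
  have : k * ka = ka + 6 * M by rewrite /k; field; rewrite gt_eqF.
  by move=> ->; lra.
have t3 : th J / ka / m%:R * return_prob D m <= 3 / (k * ka) * (C * lam / P i).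
  apply: ler_pM => //; last exact: (return_prob_ge0 W).
  by apply: divr_ge0 => //; apply: divr_ge0; apply: ltW => //; exact: theta_gt0.
have -> : C * lam / P J = lam / P J + (C - 1) * (lam / P J) by ring.
rewrite lerD2l; apply: le_trans t3 _.
have -> : 3 / (k * ka) * (C * lam / P i) = 3 / (k * ka) * M * (C * (lam / P J)).
  rewrite (P_split jJ) -/M -/i; field.
  by rewrite !gt_eqF// ?P_gt0// (lt_le_trans _ k1).
have lP : 0 < lam / P J by rewrite divr_gt0.
apply: (@le_trans _ _ (2^-1 * (C * (lam / P J)))).
  by rewrite ler_wpM2r// mulr_ge0 ?ltW// (lt_le_trans _ C0).
by rewrite mulrA ler_wpM2r ?(ltW lP)//; lra.
Qed.

Lemma theta_unbounded (X : R) : exists j, X <= th j.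
Proof.
have [j0 _ hj0] := theta_large g_gt0 g_lt1.
pose k := (Num.truncn `|X|).+1; exists (k * j0)%N.
have h := theta_pow g_gt0 k hj0.
apply: le_trans h; apply: (@le_trans _ _ k%:R).
  apply: le_trans (ler_norm _) _; exact/ltW/truncnS_gt.
by rewrite -natrX ler_nat ltnW// ltn_expl.
Qed.

(** The constant k of return_prob_decay is removed by moving down a fixed
number j1 of scales, over which theta gains the factor 3k. *)
Lemma sup_heat_kernel_bound : exists2 C : R, 0 < C &
  forall l (D : V -> R), dyadic_kernel g c K l D -> forall J n x, (0 < n)%N ->
    th J <= n%:R -> cpow D n x <= C * (l%:R ^+ d)^-1 / P J.
Proof.
have [C [k [C0 k1 H]]] := return_prob_decay.
have [j1 hj1] := theta_unbounded (3 * k).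
exists ((C + K) * P j1); first by rewrite mulr_gt0// addr_gt0.
move=> l D W J n x n0 hn; have l0 := dk_scale_gt0 W.
set lam := (l%:R ^+ d)^-1; have lam0 : 0 < lam by rewrite invr_gt0 exprn_gt0// ltr0n.
have [Jj|jJ] := ltnP J j1.
  case: n n0 hn => // n _ _; apply: le_trans (dk_pow_sup W _ _) _.
  rewrite -/lam ler_pdivlMr// mulrAC; apply: ler_wpM2r; first exact: ltW.
  apply: ler_pM => //; [exact: ltW|exact/ltW/P_gt0|by rewrite lerDr ltW|exact/P_le/ltnW].
pose i := (J - j1)%N.
have thJ : 3 * k * th i <= th J.
  rewrite -(subnKC jJ); apply: le_trans (theta_supmul g_gt0 _ _).
  by rewrite ler_wpM2r// ltW// theta_gt0.
have thi := theta_ge_half g_gt0 g_lt1 i.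
have hki : 1 * 2^-1 <= k * th i by apply: ler_pM.
have n2 : (1 < n)%N by rewrite -(ltr_nat R); lra.
have m0 : (0 < n./2)%N by rewrite half_gt0.
have n3 := half_third R n2.
apply: le_trans (dk_pow_le_return_prob W _ n2) _.
have := H l D W i n./2 m0; rewrite -/lam => h.
apply: (le_trans (h _)); first by lra.
rewrite (P_split jJ) -/i.
have -> : (C + K) * P j1 * lam / (P j1 * P i) = (C + K) * lam / P i.
  by field; rewrite !gt_eqF// ?P_gt0//.
rewrite ler_wpM2r ?invr_ge0 ?(ltW (P_gt0 _))// ler_wpM2r ?(ltW lam0)//.
by rewrite lerDl ltW.
Qed.

End Decay.

(** * Truncation at a scale *)

(** Both signs follow from (1 - r) exp r <= 1.  The linear term cancels
against a symmetric distribution, which leaves a bound by the variance. *)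
Lemma expR_quad (R : realType) (s : R) : expR s <= 1 + s + s ^+ 2 * expR `|s|.
Proof.
have A (r : R) : (1 - r) * expR r <= 1.
  have h := expR_ge1Dx (- r).
  have : (1 - r) * expR r <= expR (- r) * expR r by rewrite ler_wpM2r ?expR_ge0.
  by rewrite -expRD addNr expR0.
have [s0|s0] := leP 0 s.
  have h := A s; rewrite ger0_norm//.
  have : s * ((1 - s) * expR s) <= s * 1 by rewrite ler_wpM2l.
  by lra.
have h := A s; rewrite ltr0_norm//.
have h2 := expR_ge1Dx (- s).
have h3 := expR_ge1Dx s.
have h4 : s * expR s <= s + s ^+ 2.
  have : 0 <= - s * (expR s - (1 + s)) by rewrite mulr_ge0 ?subr_ge0 ?oppr_ge0 ?(ltW s0).
  by lra.
have : s ^+ 2 * 1 <= s ^+ 2 * expR (- s) by rewrite ler_wpM2l ?sqr_ge0//; lra.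
by lra.
Qed.

Lemma sqr_expRN (R : realType) (k : R) : 0 <= k -> k ^+ 2 * expR (- k) <= 4.
Proof.
move=> k0; have h := expR_ge1Dx (k / 2).
rewrite expRN ler_pdivrMr ?expR_gt0//.
have -> : expR k = expR (k / 2) ^+ 2.
  by rewrite expr2 -expRD; congr expR; field.
have : (k / 2) ^+ 2 <= expR (k / 2) ^+ 2.
  by rewrite lerXn2r ?nnegrE ?expR_ge0 ?divr_ge0//; lra.
by rewrite expr_div_n; lra.
Qed.

Lemma absz_intr_le (R : realType) (a : int) n : (absz a <= n)%N -> `|a%:~R| <= n%:R :> R.
Proof. by move=> an; rewrite -intr_norm -natr_absz ler_nat. Qed.

Lemma dyadic_shell m l J : (m <= 2 ^ J * l)%N ->
  (m <= l)%N \/ exists2 j, (j < J)%N & (2 ^ j * l < m <= 2 ^ j.+1 * l)%N.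
Proof.
elim: J => [|J IH]; first by rewrite mul1n; left.
move=> h; have [/IH[?|[j jJ hj]]|h'] := leqP m (2 ^ J * l)%N; first by left.
  by right; exists j => //; apply: ltnW.
by right; exists J => //; rewrite h' h.
Qed.

Section CubeInd.
Variables (R : realType) (d : nat).
Lemma cube_indicator n : summ (fun y : 'rV[int]_d => (supnorm y <= n)%N%:R : R) /\
  tsum (fun y : 'rV[int]_d => (supnorm y <= n)%N%:R : R) <= ((2 * n).+1 ^ d)%:R.
Proof.
apply: summ_fset => // s us.
apply: (@le_trans _ _ (\sum_(x <- cube d n) 1)).
  rewrite -[leLHS]/(\sum_(x <- s) (supnorm x <= n)%N%:R).
  rewrite (eq_bigr (fun x => if (supnorm x <= n)%N then 1 else 0)); last by move=> x _;
    case: (_ <= _)%N.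
  rewrite -big_mkcond -big_filter; apply: sum_subseq; rewrite ?filter_uniq ?cube_uniq//.
  by move=> x; rewrite mem_filter mem_cube => /andP[].
by rewrite big_const_seq count_predT size_cube iter_addr_0.
Qed.
End CubeInd.

Section Trunc.
Variables (R : realType) (d : nat) (g c K : R).
Hypotheses (d_gt0 : (0 < d)%N) (g_gt0 : 0 < g) (g_lt1 : g < 1) (c_gt0 : 0 < c) (K_gt0 : 0 < K).
Local Notation V := 'rV[int]_d.
Local Notation th := (theta g).
Let q : R := g / 2 ^+ d.
Let q_gt0 : 0 < q. Proof. by rewrite divr_gt0 ?exprn_gt0. Qed.
Variables (l : nat) (D : V -> R).
Hypothesis W : dyadic_kernel g c K l D.
Let lam : R := (l%:R ^+ d)^-1.
Let l_gt0 := dk_scale_gt0 W.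
Let Ds := dk_summ W.
Let ld_gt0 : 0 < l%:R ^+ d :> R. Proof. by rewrite exprn_gt0// ltr0n. Qed.
Let lam_gt0 : 0 < lam. Proof. by rewrite invr_gt0. Qed.
Variable J : nat.
Let rho := (2 ^ J * l)%N.

Definition trunc (y : V) : R := if (supnorm y <= rho)%N then D y else 0.

Lemma trunc_ge0 y : 0 <= trunc y.
Proof. by rewrite /trunc; case: ifP => // _; apply: summ_ge0 Ds. Qed.
Lemma trunc_le y : trunc y <= D y.
Proof. by rewrite /trunc; case: ifP => // _; apply: summ_ge0 Ds. Qed.
Lemma trunc_summ : summ trunc.
Proof. exact: summ_le trunc_ge0 trunc_le Ds. Qed.
Lemma trunc_even y : trunc (- y) = trunc y.
Proof. by rewrite /trunc supnormN (dk_even W). Qed.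

Lemma trunc_pow_ge0 n y : 0 <= cpow trunc n y.
Proof. by apply: summ_ge0; case: (cpow_summ n trunc_summ). Qed.

Lemma trunc_pow_le n y : cpow trunc n y <= cpow D n y.
Proof.
elim: n y => [//|n IH] y; rewrite !cpowS; apply: convol_le => //.
- by move=> z; rewrite trunc_ge0 trunc_le.
- by move=> z; rewrite trunc_pow_ge0 IH.
- exact: (dk_pow_summ W).
Qed.

(** Split each walk at a step longer than the truncation: the rest of the walk
has total mass at most 1, so each such step contributes at most the supremum of
D beyond the truncation. *)
Lemma big_jump n x : cpow D n x <= cpow trunc n x + n%:R * (K * q ^+ J * lam).
Proof.
set b := K * q ^+ J * lam.
have b0 : 0 <= b by rewrite !mulr_ge0 ?exprn_ge0// ltW.
have pns k : summ (cpow D k) by exact: (dk_pow_summ W).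
have tns k : summ (cpow trunc k) by case: (cpow_summ k trunc_summ).
elim: n x => [|n IH] x; first by rewrite mul0r addr0.
rewrite !cpowS.
have s1 := convol_term_summ x trunc_summ (tns n).
have s2 := tsumZr (mulr_ge0 (ler0n R n) b0) Ds; rewrite (dk_tsum W) mul1r in s2.
have [s3 e3] : summ (fun y => cpow D n (x - y) * b) /\ tsum (fun y => cpow D n (x - y) * b) = b.
  have [sa ea] := tsum_refl x (pns n); rewrite (dk_pow_tsum W) in ea.
  by have [? ->] := tsumZr b0 sa; rewrite ea mul1r.
have [s4 e4] := tsumD s1 s2.1; have [s5 e5] := tsumD s4 s3.
rewrite -natr1 mulrDl mul1r -[X in _ + (X + _)]s2.2 -[X in _ + (_ + X)]e3 addrA -e4 -e5.
apply: tsum_le s5 => y.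
  by rewrite mulr_ge0 ?(dk_pow_ge0 W)// summ_ge0.
have p0 := dk_pow_ge0 W n (x - y); have D0 := summ_ge0 y Ds.
rewrite /trunc; case: leqP => [h|h].
  apply: (@le_trans _ _ (D y * (cpow trunc n (x - y) + n%:R * b))).
    exact: ler_wpM2l.
  by rewrite mulrDr lerDl mulr_ge0.
rewrite mul0r add0r.
apply: (@le_trans _ _ (cpow D n (x - y) * b)).
  by rewrite mulrC; apply: ler_wpM2l => //; exact: (dk_upper W).
by rewrite lerDr; apply: mulr_ge0 => //; apply: mulr_ge0.
Qed.

Definition moment_const : R := 1 + 4 * K * 5 ^+ d.

(** Each dyadic shell 2^j l < |y| <= 2^(j+1) l contributes about
(2^j l)^2 g^j = l^2 (4g)^j; the points within distance l contribute at most l^2,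
since D has mass 1. *)
Lemma second_moment i : summ (fun y => trunc y * (y 0 i)%:~R ^+ 2) /\
  tsum (fun y => trunc y * (y 0 i)%:~R ^+ 2) <= moment_const * l%:R ^+ 2 * Psi g J.
Proof.
(* The contribution of the j-th shell, enlarged to a full cube. *)
pose F (j : nat) (y : V) : R := 4 ^+ j.+1 * l%:R ^+ 2 * (K * q ^+ j * lam) * (supnorm y <=
  2 ^ j.+1 * l)%N%:R.
pose G (y : V) : R := l%:R ^+ 2 * D y.
have [Gs Ge] := tsumZ (sqr_ge0 (l%:R : R)) Ds.
have Fs (j : nat) : summ (F j) /\ tsum (F j) <= (4 * K * 5 ^+ d) * l%:R ^+ 2 * (4 * g) ^+ j.
  have [cs ce] := cube_indicator R d (2 ^ j.+1 * l).
  have a0 : 0 <= 4 ^+ j.+1 * l%:R ^+ 2 * (K * q ^+ j * lam).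
    by rewrite !mulr_ge0 ?exprn_ge0// ltW.
  have [s e] := tsumZ a0 cs; split=> //.
  rewrite /F e.
  apply: (@le_trans _ _ (4 ^+ j.+1 * l%:R ^+ 2 * (K * q ^+ j * lam) * (5 ^+ d * (2 ^+ d) ^+
    j * l%:R ^+ d))).
    apply: ler_wpM2l => //; apply: (le_trans ce).
    rewrite exprAC -!exprMn natrX lerXn2r ?nnegrE ?mulr_ge0 ?exprn_ge0 ?ler0n//.
    rewrite -natrX -!natrM ler_nat expnS.
    have : (0 < 2 ^ j * l)%N by rewrite muln_gt0 expn_gt0.
    by rewrite -!mulnA; lia.
  rewrite /q /lam exprS !exprMn exprVn; apply: eq_ler; field.
  by rewrite !gt_eqF ?exprn_gt0// ltr0n.
have [Ss Se] := tsum_sum (index_iota 0 J) (fun j => (Fs j).1).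
have [GSs GSe] := tsumD Gs Ss.
have le y : trunc y * (y 0 i)%:~R ^+ 2 <= l%:R ^+ 2 * D y + \sum_(j <- index_iota 0 J) F j y.
  have F0 j : 0 <= F j y by exact: summ_ge0 (Fs j).1.
  have D0 := summ_ge0 y Ds.
  have yi n : (supnorm y <= n)%N -> (y 0 i)%:~R ^+ 2 <= n%:R ^+ 2 :> R.
    move=> yn; rewrite -real_normK ?num_real// lerXn2r ?nnegrE//.
    by apply: absz_intr_le; apply: leq_trans yn; exact: supnorm_coord.
  have S0 : 0 <= \sum_(j <- index_iota 0 J) F j y by apply: sumr_ge0.
  rewrite /trunc; case: leqP => [yJ|_]; last by rewrite mul0r addr_ge0// mulr_ge0// sqr_ge0.
  have [yl|[j jJ /andP[h1 h2]]] := dyadic_shell yJ.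
    apply: (@le_trans _ _ (l%:R ^+ 2 * D y)); last by rewrite lerDl.
    by rewrite mulrC ler_wpM2r// yi.
  apply: (@le_trans _ _ (F j y)); last first.
    rewrite (bigD1_seq j) ?mem_index_iota ?iota_uniq//= addrCA lerDl.
    by rewrite addr_ge0 ?mulr_ge0 ?sqr_ge0// sumr_ge0.
  rewrite /F h2 mulr1 mulrC; apply: ler_pM; rewrite ?sqr_ge0//; last exact: (dk_upper W).
  apply: le_trans (yi _ h2) _.
  by rewrite natrM natrX exprMn exprAC (_ : 2 ^+ 2 = 4 :> R)// -natrX.
split; first by apply: summ_le GSs => // y; rewrite mulr_ge0 ?trunc_ge0 ?sqr_ge0.
apply: (le_trans (tsum_le _ le GSs)).
  by move=> y; rewrite mulr_ge0 ?trunc_ge0 ?sqr_ge0.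
rewrite GSe Ge Se (dk_tsum W) mulr1.
apply: (@le_trans _ _ (l%:R ^+ 2 + \sum_(j <- index_iota 0 J) 4 * K * 5 ^+ d * l%:R ^+ 2 *
  (4 * g) ^+ j)).
  by rewrite lerD2l; apply: ler_sum => j _; exact: (Fs j).2.
rewrite -mulr_sumr.
have -> : moment_const * l%:R ^+ 2 * Psi g J =
    l%:R ^+ 2 * Psi g J + 4 * K * 5 ^+ d * l%:R ^+ 2 * Psi g J by rewrite /moment_const; ring.
apply: lerD.
  by rewrite ler_peMr ?sqr_ge0// Psi_ge1.
apply: ler_wpM2l; first by rewrite !mulr_ge0 ?exprn_ge0// ltW.
rewrite big_mkord /Psi big_ord_recr/= lerDl; apply: exprn_ge0.
by apply: mulr_ge0 => //; exact: ltW.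
Qed.

End Trunc.

(** * Exponential moments of the truncated walk *)

(** A multiplicative weight commutes with convolution, so exponential moments
of n steps are powers of those of one step. *)
Lemma cpow_tilt (R : realType) (V : zmodType) (f w : V -> R) n :
  summ f -> w 0 = 1 -> (forall x y, w (x + y) = w x * w y) ->
  (forall x, 0 <= w x) ->
  cpow (fun y => f y * w y) n = (fun x => cpow f n x * w x).
Proof.
move=> fs c0 cD cge; elim: n => [|n IH]; apply/funext => x.
  by rewrite /= /delta0; have [->|] := eqVneq x 0; rewrite ?c0 ?mulr1// !mul0r.
rewrite !cpowS IH.
have [_ <-] := tsumZr (cge x) (convol_term_summ x fs (cpow_summ n fs).1).
congr tsum; apply/funext => y; rewrite mulrACA -cD.
by rewrite (addrC y) subrK.
Qed.

Section Chernoff.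
Variables (R : realType) (d : nat) (g c K : R).
Hypotheses (d_gt0 : (0 < d)%N) (g_gt0 : 0 < g) (g_lt1 : g < 1) (c_gt0 : 0 < c) (K_gt0 : 0 < K).
Local Notation V := 'rV[int]_d.
Variables (l : nat) (D : V -> R).
Hypothesis W : dyadic_kernel g c K l D.
Variable J : nat.
Let rho := (2 ^ J * l)%N.
Local Notation tr := (trunc l D J).

Definition exp_tilt (s : R) (i : 'I_d) (y : V) : R := expR (s * (y 0 i)%:~R).

Lemma exp_tilt0 s i : exp_tilt s i 0 = 1.
Proof. by rewrite /exp_tilt mxE mulr0 expR0. Qed.
Lemma exp_tiltD s i x y : exp_tilt s i (x + y) = exp_tilt s i x * exp_tilt s i y.
Proof. by rewrite /exp_tilt mxE intrD mulrDr expRD. Qed.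
Lemma exp_tilt_ge0 s i x : 0 <= exp_tilt s i x. Proof. exact: expR_ge0. Qed.

Definition exp_moment_bound (s : R) : R :=
  1 + s ^+ 2 * expR (`|s| * rho%:R) * (moment_const d K * l%:R ^+ 2 * Psi g J).

(** By symmetry the moment is that of (exp r + exp (-r)) / 2, to which
expR_quad applies without its linear term; truncation bounds the exponent
by |s| rho. *)
Lemma exp_moment s i : summ (fun y => tr y * exp_tilt s i y) /\
  tsum (fun y => tr y * exp_tilt s i y) <= exp_moment_bound s.
Proof.
have ts := trunc_summ W J.
have t0 y : 0 <= tr y by exact: (trunc_ge0 W).
set E := expR (`|s| * rho%:R).
have E0 : 0 <= E by exact: expR_ge0.
have sy y : tr y * `|s * (y 0 i)%:~R| <= tr y * (`|s| * rho%:R).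
  rewrite /trunc; case: leqP => [h|_]; last by rewrite !mul0r.
  rewrite normrM; apply: ler_wpM2l; first exact: summ_ge0 (dk_summ W).
  apply: ler_wpM2l => //; apply: absz_intr_le; apply: leq_trans h; exact: supnorm_coord.
have cE y : tr y * expR `|s * (y 0 i)%:~R| <= tr y * E.
  have [->|tn] := eqVneq (tr y) 0; first by rewrite !mul0r.
  have tp : 0 < tr y by rewrite lt_def tn t0.
  by rewrite ler_pM2l// ler_expR -(ler_pM2l tp).
have s1 : summ (fun y => tr y * exp_tilt s i y).
  apply: summ_le (tsumZr E0 ts).1 => y; first by rewrite mulr_ge0// expR_ge0.
  apply: le_trans (cE y); rewrite ler_wpM2l// ler_expR ler_norm//.
split=> //.
have [s2 e2] := tsum_refl 0 s1.
have [s3 e3] := tsumD s1 s2; rewrite e2 in e3.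
have [m2s m2e] := second_moment d_gt0 g_gt0 g_lt1 c_gt0 K_gt0 W J i.
have q0 : 0 <= 2 * (s ^+ 2 * E).
  by apply: mulr_ge0 => //; apply: mulr_ge0 => //; exact: sqr_ge0.
have [s4 e4] := tsumZ (ler0n R 2) ts.
have [s5 e5] := tsumZ q0 m2s.
have [s6 e6] := tsumD s4 s5.
have h : tsum (fun y => tr y * exp_tilt s i y + tr (0 - y) * exp_tilt s i (0 - y)) <=
   2 * tsum tr + 2 * (s ^+ 2 * E) * tsum (fun y => tr y * (y 0 i)%:~R ^+ 2).
  rewrite -e4 -e5 -e6; apply: tsum_le s6 => y.
    by apply: addr_ge0; apply: mulr_ge0 => //; exact: expR_ge0.
  rewrite sub0r (trunc_even W) -mulrDr /exp_tilt mxE intrN mulrN.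
  have h1 := expR_quad (s * (y 0 i)%:~R).
  have h2 := expR_quad (- (s * (y 0 i)%:~R)); rewrite sqrrN normrN in h2.
  set r := s * _ in h1 h2 *.
  apply: (@le_trans _ _ (tr y * (2 + 2 * (r ^+ 2 * expR `|r|)))).
    by apply: ler_wpM2l => //; lra.
  rewrite mulrDr [tr y * 2]mulrC lerD2l.
  have := cE y; rewrite -/r => h3.
  have -> : tr y * (2 * (r ^+ 2 * expR `|r|)) = 2 * r ^+ 2 * (tr y * expR `|r|) by ring.
  have -> : 2 * (s ^+ 2 * E) * (tr y * (y 0 i)%:~R ^+ 2) = 2 * r ^+ 2 * (tr y * E).
    by rewrite /r; ring.
  by apply: ler_wpM2l => //; apply: mulr_ge0 => //; exact: sqr_ge0.
have t1 : tsum tr <= 1.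
  rewrite -(dk_tsum W); apply: tsum_le (dk_summ W) => // y; exact: (trunc_le W).
rewrite e3 in h.
have h5 : 2 * (s ^+ 2 * E) * tsum (fun y => tr y * (y 0 i)%:~R ^+ 2) <=
  2 * (s ^+ 2 * E) * (moment_const d K * l%:R ^+ 2 * Psi g J) by apply: ler_wpM2l.
rewrite /exp_moment_bound -/E.
lra.
Qed.

Lemma exp_moment_bound_ge1 s : 1 <= exp_moment_bound s.
Proof.
have CM0 : 0 <= moment_const d K by rewrite addr_ge0// !mulr_ge0 ?exprn_ge0// ltW.
rewrite lerDl; apply: mulr_ge0; first exact: mulr_ge0 (sqr_ge0 _) (expR_ge0 _).
by apply: mulr_ge0; [apply: mulr_ge0 => //; exact: sqr_ge0|exact/ltW/Psi_gt0].
Qed.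

Lemma exp_moment_boundN s : exp_moment_bound (- s) = exp_moment_bound s.
Proof. by rewrite /exp_moment_bound sqrrN normrN. Qed.

Lemma tilt_tsum m s i : summ (fun y => cpow tr m y * exp_tilt s i y) /\
  tsum (fun y => cpow tr m y * exp_tilt s i y) <= exp_moment_bound s ^+ m.
Proof.
have [ms me] := exp_moment s i.
rewrite -(@cpow_tilt _ _ _ (exp_tilt s i)) ?exp_tilt0//; last first.
- exact: exp_tilt_ge0.
- exact: exp_tiltD.
- exact: (trunc_summ W).
have [? ->] := cpow_summ m ms; split=> //.
rewrite lerXn2r ?nnegrE//.
  by apply: tsum_ge0 => y; exact: summ_ge0 ms.
exact: le_trans (exp_moment_bound_ge1 s).
Qed.

Definition tail_mass m h : R := tsum (fun y : V => cpow tr m y * (h <= supnorm y)%N%:R).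

Lemma tail_mass_summ m h : summ (fun y : V => cpow tr m y * (h <= supnorm y)%N%:R).
Proof.
apply: summ_le (cpow_summ m (trunc_summ W J)).1 => y.
  by rewrite mulr_ge0// (trunc_pow_ge0 W).
by rewrite ler_piMr ?(trunc_pow_ge0 W)//; case: (_ <= _)%N.
Qed.

(** A point of norm at least h has some coordinate at least h in absolute
value, whence the 2d exponential moments. *)
Lemma chernoff_tail m h (s : R) : (0 < h)%N -> 0 <= s ->
  tail_mass m h <= 2 * d%:R * (expR (- (s * h%:R)) * exp_moment_bound s ^+ m).
Proof.
move=> h0 s0.
pose F i y := expR (- (s * h%:R)) * (cpow tr m y * exp_tilt s i y + cpow tr m y * exp_tilt
  (- s) i y).
have Fs i : summ (F i) /\ tsum (F i) <= 2 * (expR (- (s * h%:R)) * exp_moment_bound s ^+ m).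
  have [s1 e1] := tilt_tsum m s i; have [s2 e2] := tilt_tsum m (- s) i.
  rewrite exp_moment_boundN in e2.
  have [s3 e3] := tsumD s1 s2.
  have [s4 e4] := tsumZ (expR_ge0 (- (s * h%:R))) s3.
  split=> //; rewrite e4 mulrCA; apply: ler_wpM2l; first exact: expR_ge0.
  by rewrite e3; lra.
have [Ss Se] := tsum_sum (index_enum 'I_d) (fun i => (Fs i).1).
have p0 y : 0 <= cpow tr m y by exact: (trunc_pow_ge0 W).
apply: (@le_trans _ _ (tsum (fun y => \sum_(i <- index_enum 'I_d) F i y))).
  apply: tsum_le Ss => y; first by rewrite mulr_ge0.
  have F0 i : 0 <= F i y.
    by apply: mulr_ge0; rewrite ?expR_ge0// addr_ge0// mulr_ge0// expR_ge0.
  case: leqP => [hy|_]; last by rewrite mulr0 sumr_ge0.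
  have [i hi] : exists i, (h <= absz (y 0%R i))%N.
    apply: contrapT => /forallNP H.
    suff : (supnorm y <= h.-1)%N by move=> h2; have := leq_trans hy h2;
      rewrite leqNgt ltn_predL h0.
    by apply/supnorm_leP => i; have /negP := H i; rewrite -ltnNge => hi; rewrite -ltnS prednK.
  apply: (@le_trans _ _ (F i y)); last first.
    by rewrite (bigD1 i)//= lerDl sumr_ge0.
  rewrite mulr1 /F -mulrDr mulrCA; apply: ler_peMr => //.
  rewrite mulrDr /exp_tilt -!expRD.
  have : s * h%:R <= s * (absz (y 0%R i))%:R by rewrite ler_wpM2l// ler_nat.
  rewrite natr_absz intr_norm mulNr => hs.
  have [y0|y0] := leP 0 ((y 0 i)%:~R : R).
    rewrite ger0_norm// in hs.
    apply: (@le_trans _ _ (expR (- (s * h%:R) + s * (y 0 i)%:~R)));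
      last by rewrite lerDl expR_ge0.
    by rewrite -[leLHS]expR0 ler_expR; lra.
  rewrite ltr0_norm// in hs.
  apply: (@le_trans _ _ (expR (- (s * h%:R) + - (s * (y 0 i)%:~R))));
    last by rewrite lerDr expR_ge0.
  by rewrite -[leLHS]expR0 ler_expR; lra.
rewrite Se; apply: le_trans (ler_sum _ (fun i _ => (Fs i).2)) _.
rewrite sumr_const card_ord -mulr_natr.
by apply: eq_ler; ring.
Qed.

(** To reach x in m1 + m2 steps, one of the two parts of the walk covers half
of the distance; the other is bounded by its supremum. *)
Lemma trunc_split m1 m2 h x S : (2 * h <= supnorm x)%N ->
  (forall y, cpow D m1 y <= S) -> (forall y, cpow D m2 y <= S) ->
  cpow tr (m1 + m2) x <= S * (tail_mass m1 h + tail_mass m2 h).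
Proof.
move=> hx S1 S2; have ts := trunc_summ W J.
have S0 : 0 <= S by apply: le_trans (S1 0); exact: (dk_pow_ge0 W).
have p0 m y : 0 <= cpow tr m y by exact: (trunc_pow_ge0 W).
have pS1 y : cpow tr m1 y <= S by apply: le_trans (S1 y); exact: (trunc_pow_le W).
have pS2 y : cpow tr m2 y <= S by apply: le_trans (S2 y); exact: (trunc_pow_le W).
rewrite cpowD// mulrDr.
have [s1 e1] := tsumZ S0 (tail_mass_summ m1 h).
have [s2 e2] := tsumZ S0 (tail_mass_summ m2 h).
have [s3 e3] := tsum_refl x s2.
have [s4 e4] := tsumD s1 s3.
rewrite -e1 -e2 -e3 -e4; apply: tsum_le s4 => y; first by rewrite mulr_ge0.
have : (h <= supnorm y)%N || (h <= supnorm (x - y))%N.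
  have := supnormD y (x - y); rewrite addrC subrK => h2.
  move: (supnorm y) (supnorm (x - y)) (leq_trans hx h2) => a b hab.
  by have [//|ah] := leqP h a; have [//|bh] := leqP h b; move: hab ah bh; clear; lia.
case/orP => ->.
  rewrite mulr1 mulrC; apply: (@le_trans _ _ (S * cpow tr m1 y)).
    by rewrite ler_wpM2r.
  by rewrite lerDl !mulr_ge0.
rewrite mulr1; apply: (@le_trans _ _ (S * cpow tr m2 (x - y))).
  by rewrite ler_wpM2r.
by rewrite lerDr !mulr_ge0.
Qed.

End Chernoff.

(** * The heat kernel far from the origin *)

Section Offdiag.
Variables (R : realType) (d : nat) (g c K : R).
Hypotheses (d_gt0 : (0 < d)%N) (g_gt0 : 0 < g) (g_lt1 : g < 1) (c_gt0 : 0 < c) (K_gt0 : 0 < K).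
Local Notation V := 'rV[int]_d.
Local Notation th := (theta g).
Let P (J : nat) : R := (2 ^+ d) ^+ J.
Let P_gt0 J : 0 < P J. Proof. by rewrite !exprn_gt0. Qed.
Let P_split i j : (j <= i)%N -> P i = P j * P (i - j).
Proof. by move=> ij; rewrite /P -exprD subnKC. Qed.

(** At a time m below theta J the supremum bound holds only at the smaller
scale i with theta i of order m, and pow_le_theta converts the loss
2^(d (J - i)) into a power of theta J / n. *)
Lemma decay_loss (CA Cq : R) Q : 0 < CA -> 0 < Cq ->
  (forall k, P k <= Cq * th k ^+ Q) ->
  forall l (D : V -> R), dyadic_kernel g c K l D ->
  (forall J n x, (0 < n)%N -> th J <= n%:R -> cpow D n x <= CA * (l%:R ^+ d)^-1 / P J) ->
  forall J n m x, (0 < m)%N -> n%:R <= 3 * m%:R :> R -> 0 < n%:R / th J < 1 ->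
  cpow D m x <= CA * Cq * 12 ^+ Q * (l%:R ^+ d)^-1 / P J / (n%:R / th J) ^+ Q.
Proof.
move=> CA0 Cq0 HP l D W HA J n m x m0 nm /andP[t0 t1].
have l0 := dk_scale_gt0 W.
set lam := (l%:R ^+ d)^-1; have lam0 : 0 < lam by rewrite invr_gt0 exprn_gt0// ltr0n.
set t := n%:R / th J in t0 t1 *.
have [i [iJ h1 h2]] := theta_index g J m%:R.
have him : th i <= m%:R.
  by case: h1 => [->|//]; rewrite theta0 ler1n.
apply: le_trans (HA i m x m0 him) _; rewrite -/lam.
have thi := theta_gt0 g_gt0 i; have thJ := theta_gt0 g_gt0 J.
have thji := theta_gt0 g_gt0 (J - i).
have h3 : th (J - i) <= 12 / t.
  case: h2 => [->|h2].
    by rewrite subnn theta0 ler_pdivlMr// mul1r; lra.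
  have h4 := theta_supmul g_gt0 i (J - i); rewrite subnKC// in h4.
  have h5 := theta_le4 g_gt0 i.
  rewrite ler_pdivlMr// /t mulrA ler_pdivrMr//.
  have : th (J - i) * n%:R <= th (J - i) * (12 * th i) by apply: ler_wpM2l; [exact: ltW|lra].
  by lra.
have h4 : P (J - i) <= Cq * (12 ^+ Q / t ^+ Q).
  apply: le_trans (HP _) _; rewrite -expr_div_n; apply: ler_wpM2l; first exact: ltW.
  by apply: lerXn2r h3; rewrite nnegrE ?(ltW thji)//; apply: divr_ge0 => //; exact: ltW.
have -> : CA * lam / P i = CA * lam / P J * P (J - i).
  by rewrite (P_split iJ); field; rewrite !gt_eqF ?P_gt0.
have -> : CA * Cq * 12 ^+ Q * lam / P J / t ^+ Q = CA * lam / P J * (Cq * (12 ^+ Q / t ^+ Q)).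
  by field; rewrite !gt_eqF ?P_gt0// exprn_gt0.
by apply: ler_wpM2l => //; apply: divr_ge0; [apply: mulr_ge0|]; exact: ltW.
Qed.

(** With t = n / theta J, the tilt s = k / (2^J l) is chosen so that
exp (-2k) = t.  The exponential moments then stay bounded, as
t k^2 exp k = k^2 exp (-k) <= 4, while a distance of 2 (Q + 1) units of 2^J l
gains t^(Q + 1). *)
Lemma tail_mass_small l (D : V -> R) J n m Q : dyadic_kernel g c K l D -> (m <= n)%N ->
  0 < n%:R / th J < 1 ->
  tail_mass l D J m (2 * Q.+1 * (2 ^ J * l)) <=
    2 * d%:R * expR (4 * moment_const d K) * (n%:R / th J) ^+ Q.+1.
Proof.
move=> W mn /andP[t0 t1]; have l0 := dk_scale_gt0 W.
set t := n%:R / th J in t0 t1 *.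
set rho := (2 ^ J * l)%N.
have rho0 : 0 < rho%:R :> R by rewrite ltr0n muln_gt0 expn_gt0.
have [k k0 e2k] : exists2 k, 0 <= k & expR (- (2 * k)) = t.
  exists (- ln t / 2); first by rewrite divr_ge0// oppr_ge0 ln_le0// ltW.
  by rewrite (_ : - (2 * (- ln t / 2)) = ln t) ?lnK ?posrE//; field.
have h0 : (0 < 2 * Q.+1 * rho)%N by rewrite !muln_gt0 expn_gt0.
have s0 : 0 <= k / rho%:R by rewrite divr_ge0// ltW.
apply: le_trans (chernoff_tail d_gt0 g_gt0 g_lt1 c_gt0 K_gt0 W J m h0 s0) _.
rewrite -!mulrA; apply: ler_wpM2l => //; apply: ler_wpM2l; first by rewrite ler0n.
rewrite [leRHS]mulrC; apply: ler_pM; rewrite ?expR_ge0//.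
- by apply: exprn_ge0; apply: le_trans ler01 _; exact: exp_moment_bound_ge1.
- rewrite -e2k -expRM_natl ler_expR; apply: eq_ler.
  by rewrite (natrM _ _ rho) (natrM _ 2); field; rewrite gt_eqF.
rewrite /exp_moment_bound; set z := _ * (moment_const d K * _ * _).
have CM0 : 0 <= moment_const d K by rewrite addr_ge0// !mulr_ge0 ?exprn_ge0// ltW.
have z0 : 0 <= z.
  apply: mulr_ge0; first exact: mulr_ge0 (sqr_ge0 _) (expR_ge0 _).
  by apply: mulr_ge0; [apply: mulr_ge0 => //; exact: sqr_ge0|exact/ltW/Psi_gt0].
apply: (@le_trans _ _ (expR z ^+ m)).
  rewrite lerXn2r ?nnegrE ?expR_ge0 ?addr_ge0//.
  exact: expR_ge1Dx.
rewrite -expRM_natl ler_expR.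
apply: (@le_trans _ _ (n%:R * z)); first by rewrite ler_wpM2r// ler_nat.
have -> : n%:R * z = (k ^+ 2 * expR (- k)) * moment_const d K.
  have Pp := Psi_gt0 g_gt0 J.
  have -> : n%:R = expR (- (2 * k)) * (4 ^+ J / Psi g J) :> R.
    by rewrite e2k /t -/(th J) divfK ?gt_eqF// theta_gt0.
  rewrite /z ger0_norm// divfK ?gt_eqF//.
  have -> : expR (- k) = expR (- (2 * k)) * expR k by rewrite -expRD; congr expR; ring.
  have rE : rho%:R ^+ 2 = 4 ^+ J * l%:R ^+ 2 :> R.
    by rewrite natrM natrX exprMn exprAC (_ : 2 ^+ 2 = 4 :> R)// -natrX.
  rewrite expr_div_n rE; field.
  have lR : 0 < l%:R :> R by rewrite ltr0n.
  by rewrite !gt_eqF ?exprn_gt0.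
by rewrite ler_wpM2r// sqr_expRN.
Qed.


(** For n >= theta J the supremum bound suffices.  Otherwise the big jump
already has the right order, and for the truncated walk the gain t^(Q + 1) of
tail_mass_small exceeds the loss t^-Q of decay_loss by exactly t. *)
Lemma tail_heat_kernel_bound : exists (A : nat) (C : R), [/\ (0 < A)%N, 0 < C &
  forall l (D : V -> R), dyadic_kernel g c K l D -> forall J n x, (0 < n)%N ->
    (A * (2 ^ J * l) <= supnorm x)%N ->
    cpow D n x <= C * (l%:R ^+ d)^-1 / P J * (n%:R / th J)].
Proof.
have [CA CA0 HA] := sup_heat_kernel_bound d_gt0 g_gt0 g_lt1 c_gt0 K_gt0.
have [Q [Cq [Cq0 HP]]] := pow_le_theta g_gt0 g_lt1 d.
pose E := expR (4 * moment_const d K); have E0 : 0 < E by exact: expR_gt0.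
pose S0 := CA * Cq * 12 ^+ Q.
have S00 : 0 < S0 by rewrite !mulr_gt0 ?exprn_gt0.
pose C := CA + K + S0 * (2 * (2 * d%:R * E)).
have X0 : 0 <= S0 * (2 * (2 * d%:R * E)).
  by apply: mulr_ge0; [exact: ltW|apply: mulr_ge0 => //; apply: mulr_ge0;
    rewrite ?mulr_ge0// ltW].
exists (2 * (2 * Q.+1))%N, C; split=> //.
  by apply: ltr_wpDr => //; exact: addr_gt0.
move=> l D W J n x n0 hx; have l0 := dk_scale_gt0 W.
set lam := (l%:R ^+ d)^-1; have lam0 : 0 < lam by rewrite invr_gt0 exprn_gt0// ltr0n.
have thJ := theta_gt0 g_gt0 J.
have lP : 0 < lam / P J by rewrite divr_gt0.
have nR : 0 < n%:R :> R by rewrite ltr0n.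
set t := n%:R / th J; have t0 : 0 < t by rewrite divr_gt0.
have -> : C * lam / P J * t = CA * (lam / P J * t) + K * (lam / P J * t) +
    S0 * (2 * (2 * d%:R * E)) * (lam / P J * t) by rewrite /C; ring.
have y0 : 0 < lam / P J * t by exact: mulr_gt0.
have Ky : 0 <= K * (lam / P J * t) by apply: mulr_ge0; exact: ltW.
have CAy : 0 <= CA * (lam / P J * t) by apply: mulr_ge0; exact: ltW.
have Xy : 0 <= S0 * (2 * (2 * d%:R * E)) * (lam / P J * t) by apply: mulr_ge0 => //; exact: ltW.
have [hn|hn] := leP (th J) n%:R.
  have t1 : 1 <= t by rewrite ler_pdivlMr// mul1r.
  apply: le_trans (HA l D W J n x n0 hn) _; rewrite -/lam -/(P J).
  have : CA * (lam / P J) * 1 <= CA * (lam / P J) * t by rewrite ler_wpM2l// mulr_ge0// ltW.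
  by move: Ky Xy; rewrite mulr1 !mulrA; lra.
have t1 : t < 1 by rewrite ltr_pdivrMr// mul1r.
apply: (@le_trans _ _ (cpow (trunc l D J) n x + n%:R * (K * (g / 2 ^+ d) ^+ J * lam))).
  exact: (big_jump g_gt0 K_gt0 W J n x).
have hb : n%:R * (K * (g / 2 ^+ d) ^+ J * lam) <= K * (lam / P J * t).
  have -> : n%:R * (K * (g / 2 ^+ d) ^+ J * lam) = K * n%:R * (lam / P J) * g ^+ J.
    by rewrite expr_div_n -/(P J); field; rewrite gt_eqF.
  have -> : K * (lam / P J * t) = K * n%:R * (lam / P J) * (th J)^-1 by rewrite /t; ring.
  apply: ler_wpM2l; first by rewrite !mulr_ge0// ?ltW// invr_gt0.
  rewrite /theta invf_div ler_pdivlMr ?exprn_gt0// -exprMn mulrC.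
  exact: expr_le_Psi.
suff hq : cpow (trunc l D J) n x <= S0 * (2 * (2 * d%:R * E)) * (lam / P J * t) by lra.
have [n1|n1] := leqP n 1.
  have -> : n = 1%N by case: n n0 n1 {hn t t0 t1 y0 Ky CAy Xy hb nR} => // -[].
  rewrite (cpow1 (trunc_summ W J)) /trunc leqNgt ifF//.
  apply: negbF; apply: leq_trans hx; rewrite ltn_Pmull ?muln_gt0 ?expn_gt0//; clear; lia.
have n0' : (0 < n./2)%N by rewrite half_gt0.
have hle : (n./2 <= n)%N by rewrite -{2}(odd_double_half n) -addnn addnA leq_addl.
have n0'' : (0 < n - n./2)%N.
  by rewrite subn_gt0 -{2}(odd_double_half n) -addnn addnA addnC -addn1 leq_add2l;
    case: (odd n).
have tt : 0 < n%:R / th J < 1 by rewrite -/t t0 t1.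
have HAW := HA l D W.
have B1 y := decay_loss CA0 Cq0 HP W HAW y n0' (half_third R n1) tt.
have B2 y := decay_loss CA0 Cq0 HP W HAW y n0'' (half_third_up R n1) tt.
have hx' : (2 * (2 * Q.+1 * (2 ^ J * l)) <= supnorm x)%N by rewrite mulnA.
have -> : cpow (trunc l D J) n x = cpow (trunc l D J) (n./2 + (n - n./2)) x by rewrite subnKC.
apply: le_trans (trunc_split W J hx' B1 B2) _.
have T1 := tail_mass_small Q W hle tt.
have T2 := tail_mass_small Q W (leq_subr n./2 n) tt.
rewrite -/lam -/t -/S0 -/E in T1 T2 *.
have tQ : 0 < t ^+ Q by rewrite exprn_gt0.
apply: (@le_trans _ _ (S0 * lam / P J / t ^+ Q * (2 * (2 * d%:R * E * t ^+ Q.+1)))).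
  apply: ler_wpM2l; last by lra.
  by rewrite !mulr_ge0 ?invr_ge0// ltW.
apply: eq_ler; rewrite exprS; field.
by rewrite !gt_eqF.
Qed.

End Offdiag.

(** * Summation over time *)

Lemma sum_lt_indic (R : realType) (X : R) N : 0 <= X ->
  \sum_(1 <= n < N.+1) (n%:R < X)%R%:R <= X.
Proof.
move=> X0; suff : \sum_(1 <= n < N.+1) (n%:R < X)%R%:R <= X /\
    \sum_(1 <= n < N.+1) (n%:R < X)%R%:R <= N%:R :> R by case.
elim: N => [|N [IH1 IH2]]; first by rewrite big_geq.
rewrite big_nat_recr//=; case: ltP => h; last first.
  by rewrite addr0; split=> //; apply: le_trans IH2 _; rewrite ler_nat.
by rewrite -natr1 in h *; split; [apply: le_trans (ltW h)|]; rewrite lerD2r.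
Qed.

Lemma arith_geom_sum (R : realType) (mu : R) N : 0 <= mu < 1 ->
  \sum_(1 <= n < N.+1) n%:R * mu ^+ n <= ((1 - mu) ^+ 2)^-1.
Proof.
move=> /andP[m0 m1].
have p : 0 < (1 - mu) ^+ 2 by rewrite exprn_gt0// subr_gt0.
rewrite -[leRHS]mul1r ler_pdivlMr//.
(* Closed form of the arithmetic-geometric sum. *)
have E : (\sum_(1 <= n < N.+1) n%:R * mu ^+ n) * (1 - mu) ^+ 2 =
    mu - (N%:R * (1 - mu) + 1) * mu ^+ N.+1.
  elim: N => [|N IH]; first by rewrite big_geq// expr1; ring.
  by rewrite big_nat_recr//= mulrDl IH -natr1 !exprS; ring.
rewrite E; have : 0 <= (N%:R * (1 - mu) + 1) * mu ^+ N.+1.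
  by rewrite mulr_ge0 ?exprn_ge0// addr_ge0// mulr_ge0// subr_ge0 ltW.
by lra.
Qed.

Section Green.
Variables (R : realType) (d : nat) (g c K : R).
Hypotheses (d_gt0 : (0 < d)%N) (g_gt0 : 0 < g) (g_lt1 : g < 1) (c_gt0 : 0 < c) (K_gt0 : 0 < K).
Hypothesis transient : 4 < 2 ^+ d :> R \/ g^-1 < 2 ^+ d.
Local Notation V := 'rV[int]_d.
Local Notation th := (theta g).
Let P (J : nat) : R := (2 ^+ d) ^+ J.
Let P_gt0 J : 0 < P J. Proof. by rewrite !exprn_gt0. Qed.

(** J is the scale of x, or 0 when x is within distance 2 A l.  The
second bound is the one that improves away from mu = 1. *)
Lemma green_bound : exists (A : nat) (C : R), [/\ (0 < A)%N, 0 < C &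
  forall l (D : V -> R), dyadic_kernel g c K l D -> forall x, exists J : nat,
  [/\ J = 0%N \/ (2 ^ J * (A * l) <= supnorm x)%N, (supnorm x <= 2 ^ J.+1 * (A * l))%N,
   forall (mu : R) N, 0 <= mu <= 1 ->
     \sum_(1 <= n < N.+1) mu ^+ n * cpow D n x <= C * (l%:R ^+ d)^-1 / P J * th J &
   forall (mu : R) N, 0 <= mu < 1 ->
     \sum_(1 <= n < N.+1) mu ^+ n * cpow D n x <=
       C * (l%:R ^+ d)^-1 / P J / th J * ((1 - mu) ^+ 2)^-1]].
Proof.
have [A [C1 [A0 C10 HB]]] := tail_heat_kernel_bound d_gt0 g_gt0 g_lt1 c_gt0 K_gt0.
have [CA CA0 HA] := sup_heat_kernel_bound d_gt0 g_gt0 g_lt1 c_gt0 K_gt0.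
have [Cs [Cs0 HS]] := theta_decay g_gt0 transient.
pose C2 := C1 + K + CA; have C20 : 0 < C2 by rewrite !addr_gt0.
exists A, (C2 * (1 + Cs)); split=> //; first by rewrite mulr_gt0// addr_gt0.
move=> l D W x; have l0 := dk_scale_gt0 W.
set lam := (l%:R ^+ d)^-1; have lam0 : 0 < lam by rewrite invr_gt0 exprn_gt0// ltr0n.
have [J hJ1 hJ2] : exists2 J, J = 0%N \/ (2 ^ J * (A * l) <= supnorm x)%N & (supnorm x <=
  2 ^ J.+1 * (A * l))%N.
  have h : (supnorm x <= 2 ^ (supnorm x) * (A * l))%N.
    by rewrite (leq_trans (ltnW (ltn_expl _ (ltnSn 1))))// leq_pmulr// muln_gt0 A0.
  have [h0|[j _ /andP[h1 h2]]] := dyadic_shell h.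
    by exists 0%N; [left|rewrite (leq_trans h0)// leq_pmull].
  by exists j => //; right; exact: ltnW.
exists J.
have thJ := theta_gt0 g_gt0 J.
have lP i : 0 < lam / P i by rewrite divr_gt0.
have p0 n : 0 <= cpow D n x by exact: (dk_pow_ge0 W).
have p_any n : (0 < n)%N -> cpow D n x <= (C1 + K) * (lam / P J) * (n%:R / th J).
  move=> n0; case: hJ1 => [J0|hJ1].
    case: n n0 => // n _; apply: le_trans (dk_pow_sup W _ _) _;
      rewrite -/lam J0 theta0 /P expr0 !divr1.
    apply: (@le_trans _ _ (K * lam * n.+1%:R)).
      by rewrite ler_peMr ?ler1n// mulr_ge0// ltW.
    by rewrite !ler_wpM2r// ?(ltW lam0)// lerDr ltW.
  apply: le_trans (HB l D W J n x n0 _) _; first by rewrite mulnCA.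
  have y0 : 0 <= lam / P J * (n%:R / th J) by rewrite mulr_ge0 ?(ltW (lP _))// divr_ge0// ltW.
  rewrite -/lam -/(P J) -[leRHS]mulrA -!(mulrA C1); apply: ler_wpM2r.
    by move: y0; rewrite !mulrA.
  by rewrite lerDl ltW.
have p_late i n : (0 < n)%N -> th i <= n%:R -> cpow D n x <= CA * (lam / P i).
  by move=> n0 hn; rewrite mulrA; exact: (HA l D W).
split=> //.
- move=> mu N /andP[m0 m1].
  (* Theta need not be monotone, so its values do not cut time into
     consecutive intervals; n is charged to J if it is below theta J, and
     otherwise to some i with theta i <= n < theta (i + 1). *)
  have H I n : (0 < n)%N -> n%:R < th (J + I) -> cpow D n x <=
     C2 * lam * ((n%:R < th J)%R%:R / P J + \sum_(J <= i < J + I) (n%:R < th i.+1)%R%:R / P i).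
    elim: I n => [|I IH] n n0 hn.
      rewrite addn0 in hn; rewrite addn0 big_geq// addr0 hn.
      apply: le_trans (p_any n n0) _.
      apply: (@le_trans _ _ ((C1 + K) * (lam / P J) * 1)).
        apply: ler_wpM2l; first by rewrite mulr_ge0 ?addr_ge0 ?ltW.
        by rewrite ler_pdivrMr// mul1r ltW.
      rewrite mulr1 mul1r -mulrA; apply: ler_wpM2r; first exact: ltW.
      by rewrite lerDl ltW.
    rewrite addnS big_nat_recr ?leq_addr//=.
    have T0 i : 0 <= (n%:R < th i.+1)%R%:R / P i :> R by rewrite divr_ge0// ltW.
    have T1 : 0 <= (n%:R < th J)%R%:R / P J :> R by rewrite divr_ge0// ltW.
    have CL : 0 <= C2 * lam by rewrite mulr_ge0 ?ltW.
    have [h|h] := ltP n%:R (th (J + I)).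
      apply: le_trans (IH n n0 h) _; apply: ler_wpM2l => //.
      by rewrite addrA lerDl.
    rewrite -addnS hn; apply: le_trans (p_late _ _ n0 h) _.
    apply: (@le_trans _ _ (C2 * lam * (1 / P (J + I)))).
      rewrite mul1r -mulrA; apply: ler_wpM2r; first exact: ltW.
      by rewrite lerDr addr_ge0// ltW.
    by apply: ler_wpM2l => //; rewrite addrA lerDr addr_ge0// sumr_ge0.
  (* A scale beyond all times up to N. *)
  have [I hI] := theta_unbounded g_gt0 g_lt1 (N.+1%:R / th J).
  have hI' : N.+1%:R <= th (J + I).
    apply: le_trans (theta_supmul g_gt0 _ _).
    by move: hI; rewrite ler_pdivrMr// mulrC.
  apply: (@le_trans _ _ (\sum_(1 <= n < N.+1) C2 * lam * ((n%:R < th J)%R%:R / P J +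
    \sum_(J <= i < J + I) (n%:R < th i.+1)%R%:R / P i))).
    rewrite big_nat [leRHS]big_nat; apply: ler_sum => n /andP[n1 nN].
    apply: (@le_trans _ _ (cpow D n x)); first by rewrite ler_piMl// exprn_ile1.
    by apply: H => //; apply: lt_le_trans hI'; rewrite ltr_nat.
  rewrite -mulr_sumr big_split/= exchange_big/=.
  have hC : \sum_(1 <= n < N.+1) (n%:R < th J)%R%:R / P J +
    \sum_(J <= i < J + I) \sum_(1 <= n < N.+1) (n%:R < th i.+1)%R%:R / P i <=
      (1 + Cs) * (th J / P J).
    rewrite mulrDl mul1r; apply: lerD.
      rewrite -mulr_suml; apply: ler_wpM2r; first by rewrite invr_ge0 ltW.
      exact: sum_lt_indic (ltW thJ).
    apply: le_trans (HS J (J + I)); apply: ler_sum => i _.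
    rewrite -mulr_suml; apply: ler_wpM2r; first by rewrite invr_ge0 ltW.
    exact/sum_lt_indic/ltW/theta_gt0.
  apply: (@le_trans _ _ (C2 * lam * ((1 + Cs) * (th J / P J)))).
    by apply: ler_wpM2l => //; rewrite mulr_ge0 ?ltW.
  by apply: eq_ler; field; rewrite gt_eqF.
- move=> mu N m01; have /andP[m0 m1] := m01.
  apply: (@le_trans _ _ ((C1 + K) * (lam / P J) / th J * \sum_(1 <= n < N.+1) n%:R * mu ^+ n)).
    rewrite mulr_sumr big_nat [leRHS]big_nat; apply: ler_sum => n /andP[n1 nN].
    apply: (@le_trans _ _ (mu ^+ n * ((C1 + K) * (lam / P J) * (n%:R / th J)))).
      by rewrite ler_wpM2l ?exprn_ge0// p_any.
    by apply: eq_ler; ring.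
  apply: ler_pM.
  + apply: divr_ge0; last exact: ltW.
    by apply: mulr_ge0; [apply: addr_ge0|]; exact: ltW.
  + by rewrite sumr_ge0// => n _; rewrite mulr_ge0 ?exprn_ge0.
  + rewrite ler_wpM2r ?invr_ge0 ?(ltW thJ)// -[leRHS]mulrA ler_wpM2r ?(ltW (lP _))//.
    rewrite mulrDr mulr1; apply: (@le_trans _ _ C2); first by rewrite lerDl ltW.
    by rewrite lerDl mulr_ge0 ?ltW.
  + exact: arith_geom_sum.
Qed.

End Green.

(** * The two-point function as a sum over time *)

Section Paths.
Variables (R : realType) (d : nat) (D : 'rV[int]_d -> R) (mu : R).
Hypotheses (Ds : summ D) (mu0 : 0 <= mu).
Local Notation V := 'rV[int]_d.
Local Notation wt := (path_weight D mu).

Lemma path_weight_ge0 w : 0 <= wt w.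
Proof. by apply: prodr_ge0 => j _; rewrite mulr_ge0// summ_ge0. Qed.

Lemma path_weight_rcons (w : seq V) (x : V) : (0 < size w)%N ->
  wt (rcons w x) = wt w * (mu * D (x - last 0 w)).
Proof.
move=> w0; rewrite /path_weight size_rcons big_nat_recr//=; congr (_ * (mu * D (_ - _))).
- rewrite big_nat [RHS]big_nat; apply: eq_bigr => j /andP[j1 jw].
  by rewrite !nth_rcons jw (leq_ltn_trans (leq_pred _) jw).
- by rewrite nth_rcons ltnn eqxx.
- by rewrite nth_rcons prednK// leqnn nth_last.
Qed.

(** Induction on the length: removing the last site sorts the paths by their
last step y, and Tonelli exchanges the sum over paths with the sum over y. *)
Lemma path_weight_sum n (x : V) (s : seq (seq V)) : uniq s ->
  (forall w, w \in s -> [/\ size w = n.+1, w`_0 = 0 & last 0 w = x]) ->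
  \sum_(w <- s) wt w <= mu ^+ n * cpow D n x.
Proof.
elim: n x s => [|n IH] x s us sP.
  have [s0|[w ws]] : s = [::] \/ exists w, w \in s.
    by case: s {us sP} => [|w s]; [left|right; exists w; rewrite mem_head].
    rewrite s0 big_nil expr0 mul1r /= /delta0; case: (_ == _) => //.
  have sE w' : w' \in s -> w' = [:: 0].
    by move=> /sP[]; case: w' => [//|a []]//= _ ->.
  have [_ _ lw] := sP w ws; have wE := sE w ws; rewrite wE /= in lw.
  rewrite -lw expr0 mul1r /= /delta0 eqxx.
  have -> : \sum_(w <- s) wt w = \sum_(w <- [:: [:: 0 : V]]) wt w.
    apply: perm_big; apply: uniq_perm => // w'; rewrite inE; apply/idP/eqP => [/sE//|->].
    by rewrite -wE.
  by rewrite big_seq1 /path_weight big_geq.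
pose s' := [seq take n.+1 w | w <- s].
have tw w : w \in s -> w = rcons (take n.+1 w) x.
  move=> /sP[sz _ lw]; rewrite -lw; case/lastP: w sz lw => // w a.
  rewrite size_rcons => -[sz] _; by rewrite last_rcons -sz -[rcons w a]cats1
    take_size_cat// cats1.
have us' : uniq s'.
  rewrite map_inj_in_uniq// => w1 w2 /tw e1 /tw e2 e.
  by rewrite e1 e2 e.
have s'P w : w \in s' -> size w = n.+1 /\ w`_0 = 0.
  move=> /mapP[w1 /[dup] /sP[sz w10 _] /tw e ->].
  by rewrite size_takel ?sz// nth_take.
have -> : \sum_(w <- s) wt w = \sum_(w <- s') wt w * (mu * D (x - last 0 w)).
  rewrite big_map big_seq [RHS]big_seq; apply: eq_bigr => w ws.
  rewrite {1}(tw w ws) path_weight_rcons//.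
  by have [-> _] := s'P _ (map_f (take n.+1) ws).
pose f w y : R := if y == x - last 0 w then wt w * (mu * D y) else 0.
have fE w : summ (f w) /\ tsum (f w) = wt w * (mu * D (x - last 0 w)).
  have [||? ->] := @tsum_delta R V (x - last 0 w) (f w).
  - by move=> y; rewrite /f => /negbTE->.
  - by rewrite /f eqxx mulr_ge0 ?path_weight_ge0// mulr_ge0// summ_ge0.
  - by rewrite /f eqxx.
under eq_bigr do rewrite -(fE _).2.
have [Fs <-] := tsum_sum s' (fun w => (fE w).1).
have [cs _] := cpow_summ n Ds.
have [s1 e1] := tsumZ (exprn_ge0 n.+1 mu0) (convol_term_summ x Ds cs).
rewrite cpowS -e1; apply: tsum_le s1 => y.
  by apply: sumr_ge0 => w _; apply: summ_ge0 (fE w).1.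
rewrite /f -big_mkcond/= -mulr_suml.
have -> : mu ^+ n.+1 * (D y * cpow D n (x - y)) = mu ^+ n * cpow D n (x - y) * (mu * D y).
  by rewrite exprS; ring.
apply: ler_wpM2r; first by rewrite mulr_ge0// summ_ge0.
rewrite -big_filter; apply: IH; first by rewrite filter_uniq.
move=> w; rewrite mem_filter => /andP[/eqP -> /s'P[-> ->]]; split=> //.
by rewrite subKr.
Qed.

(** A finite family of paths has bounded lengths, so partial sums over n
suffice; length 0 gives the Kronecker delta. *)
Lemma two_point_le x B : (forall N, \sum_(1 <= n < N.+1) mu ^+ n * cpow D n x <= B) ->
  (two_point D mu x <= ((x == 0)%:R + B)%:E)%E.
Proof.
move=> HB; apply: ge_ereal_sup => _ [X [finX XP] <-].
rewrite fsbig_finite//= sumEFin lee_fin.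
set s : seq (seq V) := finmap.enum_fset (fset_set X).
have us : uniq s by exact: finmap.fset_uniq.
have sP w : w \in s -> paths x w.
  by rewrite /s in_fset_set// inE => /XP.
pose N := \max_(w <- s) size w.
have sN w : w \in s -> (size w <= N)%N.
  by move=> ws; rewrite /N; apply: (@leq_bigmax_seq _ s xpredT (fun w => size w)).
apply: (@le_trans _ _ (\sum_(0 <= n < N.+1) mu ^+ n * cpow D n x)); last first.
  by rewrite big_ltn// expr0 mul1r lerD2l.
apply: (@le_trans _ _ (\sum_(0 <= n < N.+1) \sum_(w <- s | size w == n.+1) wt w)).
  under [leRHS]eq_bigr do rewrite big_mkcond.
  rewrite exchange_big/= big_seq [leRHS]big_seq; apply: ler_sum => w ws.
  have [w0 _ _] := sP w ws.
  rewrite (bigD1_seq (size w).-1) ?iota_uniq//=; last first.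
    by rewrite mem_index_iota/= prednK// leqW// sN.
  rewrite prednK// eqxx lerDl; apply: sumr_ge0 => n _.
  by case: ifP => // _; exact: path_weight_ge0.
apply: ler_sum => n _; rewrite -big_filter; apply: path_weight_sum;
  first by rewrite filter_uniq.
move=> w; rewrite mem_filter => /andP[/eqP sz /sP[_ w0 lw]].
by split.
Qed.

End Paths.

(** * Kernels with polynomial tails are dyadic kernels *)

Lemma powR_le (R : realType) (p a b : R) : 0 <= p -> 0 <= a -> a <= b -> a `^ p <= b `^ p.
Proof.
by move=> p0 a0 ab; apply: ge0_ler_powR; rewrite ?nnegrE// (le_trans a0).
Qed.

Section Norms.
Variables (R : realType) (d : nat).
Local Notation V := 'rV[int]_d.

(** Interpolates, coordinate by coordinate, between x and -x. *)
Definition reflect_seq (s : seq 'I_d) (x : V) : V :=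
  \row_k (if k \in s then - x 0 k else x 0 k).

Lemma Zd_symmetric_even (f : V -> R) : Zd_symmetric f -> forall x, f (- x) = f x.
Proof.
move=> [fr _] x.
have H (s : seq 'I_d) : uniq s -> f (reflect_seq s x) = f x.
  elim: s => [_|i s IH /= /andP[iNs us]].
    by congr f; apply/rowP => k; rewrite mxE in_nil.
  rewrite -(IH us) -[RHS](fr i); congr f; apply/rowP => k; rewrite !mxE inE.
  have [->|ki] /= := eqVneq k i; first by rewrite (negbTE iNs).
  by [].
rewrite -(H (enum 'I_d) (enum_uniq _)); congr f; apply/rowP => k.
by rewrite !mxE mem_enum.
Qed.

Lemma supnorm_le_eucl (x : V) : (supnorm x)%:R <= eucl_norm (vec_of_int R x).
Proof.
have H i : (absz (x 0%R i))%:R <= eucl_norm (vec_of_int R x).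
  rewrite natr_absz intr_norm -sqrtr_sqr /eucl_norm ler_wsqrtr//.
  by rewrite (bigD1 i)//= !mxE lerDl sumr_ge0// => j _; rewrite sqr_ge0.
rewrite /supnorm; elim/big_rec: _ => [|i n _ IH]; first exact: sqrtr_ge0.
by rewrite /maxn; case: ifP => _ //; exact: H.
Qed.

Lemma eucl_le_supnorm (x : V) : eucl_norm (vec_of_int R x) <= d%:R * (supnorm x)%:R.
Proof.
rewrite /eucl_norm; have [d0|d0] := posnP d.
  rewrite big1 ?sqrtr0 ?mulr_ge0// => i _; exfalso.
  by have := ltn_ord i; rewrite {2}d0.
rewrite -[leRHS]ger0_norm ?mulr_ge0// -sqrtr_sqr ler_wsqrtr//.
apply: (@le_trans _ _ (\sum_(i < d) (supnorm x)%:R ^+ 2)).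
  apply: ler_sum => i _; rewrite !mxE -real_normK ?num_real//.
  rewrite lerXn2r ?nnegrE//; apply: absz_intr_le; exact: supnorm_coord.
rewrite sumr_const card_ord -[_ *+ d]mulr_natl exprMn ler_wpM2r ?sqr_ge0//.
by rewrite -natrX ler_nat -[leqLHS]expn1 leq_pexp2l.
Qed.

End Norms.

Section Bridge.
Variables (R : realType) (d : nat) (alpha KD : R).
Hypotheses (alpha_gt0 : 0 < alpha) (d_ge1 : (1 <= d)%N) (KD_ge1 : 1 <= KD).
Local Notation V := 'rV[int]_d.

(** The probability that a step exceeds 2^j l decreases by this factor with
each j. *)
Definition tail_ratio : R := 2 `^ (- alpha).
Lemma tail_ratio_gt0 : 0 < tail_ratio. Proof. exact: powR_gt0. Qed.
Lemma tail_ratio_inv : tail_ratio^-1 = 2 `^ alpha. Proof. by rewrite /tail_ratio powRN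
  invrK. Qed.
Lemma tail_ratio_lt1 : tail_ratio < 1.
Proof.
rewrite -[tail_ratio]invrK tail_ratio_inv invf_lt1 ?powR_gt0// -[ltLHS](powRr0 2).
rewrite /powR gt_eqF//= mul0r ltr_expR mulr_gt0// ln_gt0// ltr1n//.
Qed.

Let dim_alpha := d%:R + alpha.
Let dim_alpha_gt0 : 0 < dim_alpha. Proof. by rewrite addr_gt0// ltr0n. Qed.

Lemma pow2_dim_alpha j : ((2 ^ j)%:R : R) `^ dim_alpha = ((tail_ratio / 2 ^+ d) ^+ j)^-1.
Proof.
rewrite natrX -powR_mulrn// powRAC powR_mulrn ?powR_ge0// -[RHS]exprVn.
by rewrite invf_div powRD ?pnatr_eq0 ?implybT// powR_mulrn// -tail_ratio_inv.
Qed.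

Lemma powR_dim_alpha (r : R) : 0 < r -> r `^ dim_alpha = r ^+ d * r `^ alpha.
Proof.
by move=> r0; rewrite powRD ?(gt_eqF r0) ?implybT// powR_mulrn// ltW.
Qed.

Definition lower_const : R := KD^-1 / (4 * d%:R) `^ dim_alpha.
Definition upper_const : R := KD / tail_ratio.

Lemma lower_const_gt0 : 0 < lower_const.
Proof.
rewrite divr_gt0 ?invr_gt0 ?powR_gt0//; first exact: lt_le_trans KD_ge1.
by rewrite mulr_gt0// ltr0n.
Qed.

Lemma upper_const_gt0 : 0 < upper_const.
Proof. by rewrite divr_gt0 ?tail_ratio_gt0// (lt_le_trans _ KD_ge1). Qed.

(** Passing from L to its integer part loses at most a factor 2, so that cubes
may have integer radii. *)
Lemma truncn_bounds (L : R) : 1 <= L ->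
  [/\ (0 < Num.truncn L)%N, (Num.truncn L)%:R <= L & L <= 2 * (Num.truncn L)%:R].
Proof.
move=> L1; have L0 : 0 <= L by apply: le_trans L1.
have /andP[h1 h2] := truncn_itv L0.
have l0 : (0 < Num.truncn L)%N by rewrite truncn_gt0.
split=> //; apply: le_trans (ltW h2) _.
by rewrite -natrM ler_nat mul2n -addnn -addn1 leq_add2l.
Qed.

(** |||x|||_L, max(|x|, L) and the same quantity in the sup norm are
comparable up to factors depending on d only. *)
Lemma dyadic_kernel_of_assumptionA (L Delta : R) (D : V -> R) : 1 <= L ->
  assumptionA L alpha KD Delta D -> dyadic_kernel tail_ratio lower_const upper_const
    (Num.truncn L) D.
Proof.
move=> L1 HA; have [l0 lL Ll] := truncn_bounds L1.
set l := Num.truncn L in l0 lL Ll *.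
have L0 : 0 < L by apply: lt_le_trans L1.
have lR : 0 < l%:R :> R by rewrite ltr0n.
have K0 : 0 < KD by apply: lt_le_trans KD_ge1.
have [Ds Dt] := summ_tsumE (D_ge0 HA) (D_sum1 HA).
have g0 := tail_ratio_gt0.
have La : L `^ alpha <= tail_ratio^-1 * l%:R `^ alpha.
  rewrite tail_ratio_inv -powRM//; by apply: powR_le => //; exact: ltW.
pose tau (x : V) : R := tnorm L (vec_of_int R x).
have tau1 x : eucl_norm (vec_of_int R x) <= tau x /\ L <= tau x.
  have := pihalf_ge1 R; rewrite /tau /tnorm => p1.
  have m0 : 0 <= Num.max (eucl_norm (vec_of_int R x)) L by rewrite le_max (ltW L0) orbT.
  by split; apply: le_trans (ler_peMl m0 p1); rewrite le_max lexx ?orbT.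
have up x r : x != 0 -> 0 < r -> r <= tau x -> D x <= KD * L `^ alpha / r `^ dim_alpha.
  move=> x0 r0 rt; apply: le_trans (D_upper HA x0) _.
  apply: ler_wpM2l; first by rewrite mulr_ge0 ?powR_ge0// ltW.
  rewrite lef_pV2 ?posrE ?powR_gt0//; last exact: lt_le_trans rt.
  by apply: powR_le => //; exact: ltW.
split=> //.
- exact: Zd_symmetric_even (D_sym HA).
- exact: D_0 HA.
- move=> x j x0 xj; apply: le_trans (D_lower HA x0).
  have t0 : 0 < tau x by apply: lt_le_trans (tau1 x).2.
  have tle : tau x <= 4 * d%:R * ((2 ^ j)%:R * l%:R).
    have p2 := ltW (pihalf_lt2 R).
    have dR : 1 <= d%:R :> R by rewrite ler1n.
    have j1 : 1 <= (2 ^ j)%:R :> R by rewrite ler1n expn_gt0.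
    have Mle : Num.max (eucl_norm (vec_of_int R x)) L <= 2 * d%:R * ((2 ^ j)%:R * l%:R).
      rewrite ge_max; apply/andP; split.
        apply: le_trans (eucl_le_supnorm _ _) _.
        rewrite -natrM -mulrA -!natrM ler_nat.
        rewrite -[leqLHS]mul1n leq_mul// leq_mul//.
      apply: le_trans Ll _; rewrite -mulrA ler_pM2l// mulrA.
      rewrite -[leLHS]mul1r ler_wpM2r ?(ltW lR)//.
      by rewrite -[leLHS]mul1r ler_pM.
    rewrite /tau /tnorm; apply: (@le_trans _ _ (2 * (2 * d%:R * ((2 ^ j)%:R * l%:R)))).
      apply: ler_pM => //; first by rewrite divr_ge0// ltW// pi_gt0.
      by rewrite le_max (ltW L0) orbT.
    by rewrite !mulrA -natrM.
  have la : l%:R `^ alpha <= L `^ alpha.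
    by apply: powR_le => //; exact: ltW.
  have tp : tau x `^ dim_alpha <= (4 * d%:R) `^ dim_alpha * (((tail_ratio / 2 ^+ d) ^+
    j)^-1 * (l%:R ^+ d * l%:R `^ alpha)).
    rewrite -pow2_dim_alpha -powR_dim_alpha// -!powRM ?mulr_ge0//.
    by apply: powR_le => //; exact: ltW.
  have q0 : 0 < (tail_ratio / 2 ^+ d) ^+ j by rewrite exprn_gt0// divr_gt0// exprn_gt0.
  have d4 : 0 < (4 * d%:R) `^ dim_alpha by rewrite powR_gt0// mulr_gt0// ltr0n.
  have l_a : 0 < l%:R `^ alpha by rewrite powR_gt0.
  have ld : 0 < l%:R ^+ d :> R by rewrite exprn_gt0.
  rewrite -/(tau x) -/dim_alpha ler_pdivlMr ?powR_gt0//.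
  have A0 : 0 <= lower_const * (tail_ratio / 2 ^+ d) ^+ j / l%:R ^+ d.
    apply: divr_ge0; last exact: ltW.
    by apply: mulr_ge0; apply: ltW => //; exact: lower_const_gt0.
  apply: le_trans (ler_wpM2l A0 tp) _.
  have -> : lower_const * (tail_ratio / 2 ^+ d) ^+ j / l%:R ^+ d *
    ((4 * d%:R) `^ dim_alpha * (((tail_ratio / 2 ^+ d) ^+ j)^-1 * (l%:R ^+ d * l%:R `^
      alpha))) = KD^-1 * l%:R `^ alpha.
    rewrite /lower_const; move: q0 d4 ld K0; clear.
    move: ((tail_ratio / 2 ^+ d) ^+ j) ((4 * d%:R) `^ dim_alpha) (l%:R ^+ d) (l%:R `^
      alpha) => a b e f a0 b0 e0 K0.
    by field; rewrite !gt_eqF.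
  by apply: ler_wpM2l => //; rewrite invr_ge0 ltW.
- move=> x j xj.
  have x0 : x != 0 by apply: contraTneq xj => ->; rewrite supnorm0 ltn0.
  have r0 : 0 < (2 ^ j * l)%N%:R :> R by rewrite ltr0n muln_gt0 expn_gt0.
  have rt : (2 ^ j * l)%N%:R <= tau x.
    apply: le_trans (tau1 x).1; apply: le_trans (supnorm_le_eucl _ _).
    by rewrite ler_nat ltnW.
  apply: le_trans (up x _ x0 r0 rt) _.
  rewrite natrM powRM// pow2_dim_alpha powR_dim_alpha//.
  have q0 : 0 < (tail_ratio / 2 ^+ d) ^+ j by rewrite exprn_gt0// divr_gt0// exprn_gt0.
  have l_a : 0 < l%:R `^ alpha by rewrite powR_gt0.
  have ld : 0 < l%:R ^+ d :> R by rewrite exprn_gt0.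
  apply: (@le_trans _ _ (KD * (tail_ratio^-1 * l%:R `^ alpha) / (((tail_ratio / 2 ^+ d) ^+
    j)^-1 * (l%:R ^+ d * l%:R `^ alpha)))).
    apply: ler_wpM2r; last by rewrite ler_pM2l.
    by rewrite invr_ge0 !mulr_ge0 ?invr_ge0 ?ltW.
  rewrite /upper_const; apply: eq_ler.
  move: q0 l_a ld g0; clear.
  move: ((tail_ratio / 2 ^+ d) ^+ j) (l%:R ^+ d) (l%:R `^ alpha) tail_ratio =>
    a b e f a0 b0 e0 K0.
  by field; rewrite !gt_eqF.
- move=> x; have [->|x0] := eqVneq x 0.
    by rewrite (D_0 HA) divr_ge0 ?exprn_ge0// ltW// upper_const_gt0.
  apply: le_trans (up x L x0 L0 (tau1 x).2) _.
  rewrite powR_dim_alpha// invfM mulrA mulrAC -(mulrA KD) divff ?mulr1;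
    last by rewrite gt_eqF// powR_gt0.
  apply: ler_pM.
  + exact: ltW.
  + by rewrite invr_ge0 exprn_ge0// ltW.
  + by rewrite /upper_const ler_peMr ?(ltW K0)// invf_ge1// ltW// tail_ratio_lt1.
  + by rewrite lef_pV2 ?posrE ?exprn_gt0// lerXn2r ?nnegrE// ltW.
Qed.

End Bridge.

(** * Asymptotics of theta and the final bounds *)

Section ThetaAsymptotics.
Variables (R : realType) (g : R).
Hypotheses (g_gt0 : 0 < g) (g_lt1 : g < 1).

Lemma Psi_geom J : (4 * g - 1) * Psi g J = (4 * g) ^+ J.+1 - 1.
Proof.
elim: J => [|J IH]; first by rewrite Psi0 expr1 mulr1.
by rewrite PsiSr mulrDr IH (exprS _ J.+1); ring.
Qed.

(** The case alpha < 2: the last term of Psi dominates. *)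
Lemma theta_asym_gt : 1 < 4 * g -> exists2 C, 0 < C & forall J,
  theta g J <= C * (g^-1) ^+ J /\ (theta g J)^-1 <= C / (g^-1) ^+ J.
Proof.
move=> g4; have b0 : 0 < 4 * g by rewrite mulr_gt0.
have c0 : 0 < 4 * g - 1 by lra.
have q0 : 0 < 4 * g / (4 * g - 1) by rewrite divr_gt0.
exists (1 + 4 * g / (4 * g - 1)); first by rewrite addr_gt0.
move=> J; have gJ : 0 < g ^+ J by rewrite exprn_gt0.
have P0 := Psi_gt0 g_gt0 J; split.
  apply: (@le_trans _ _ (1 * (g^-1) ^+ J)); last first.
    by rewrite ler_wpM2r ?exprn_ge0 ?invr_ge0 ?(ltW g_gt0)// lerDl ltW.
  rewrite mul1r /theta exprVn ler_pdivrMr// mulrC ler_pdivlMr// -exprMn.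
  exact: expr_le_Psi.
rewrite exprVn invrK /theta invf_div ler_pdivrMr ?exprn_gt0// -[leRHS]mulrA.
rewrite -exprMn (mulrC g).
apply: (@le_trans _ _ (4 * g / (4 * g - 1) * (4 * g) ^+ J)); last first.
  by rewrite ler_wpM2r ?exprn_ge0 ?(ltW b0)// lerDr.
rewrite -(ler_pM2l c0) Psi_geom exprS.
have -> : (4 * g - 1) * (4 * g / (4 * g - 1) * (4 * g) ^+ J) = 4 * g * (4 * g) ^+ J.
  by field; rewrite gt_eqF.
lra.
Qed.

(** The case alpha > 2: Psi is bounded. *)
Lemma theta_asym_lt : 4 * g < 1 -> exists2 C, 0 < C & forall J,
  theta g J <= C * 4 ^+ J /\ (theta g J)^-1 <= C / 4 ^+ J.
Proof.
move=> g4; have c0 : 0 < 1 - 4 * g by lra.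
exists (1 + (1 - 4 * g)^-1); first by rewrite addr_gt0// invr_gt0.
have i0 : 0 < (1 - 4 * g)^-1 by rewrite invr_gt0.
move=> J; have J4 : 0 < 4 ^+ J :> R by rewrite exprn_gt0.
have P0 := Psi_gt0 g_gt0 J; have P1 := Psi_ge1 g_gt0 J; split.
  rewrite /theta ler_pdivrMr// mulrAC ler_peMl ?(ltW J4)//.
  by rewrite -[leLHS]mulr1; apply: ler_pM => //; lra.
rewrite /theta invf_div ler_wpM2r ?invr_ge0 ?(ltW J4)//.
apply: (@le_trans _ _ (1 - 4 * g)^-1); last by rewrite lerDr.
rewrite -[leRHS]mul1r ler_pdivlMr// mulrC.
have := Psi_geom J; have : 0 <= (4 * g) ^+ J.+1 by rewrite exprn_ge0// mulr_ge0// ltW.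
by lra.
Qed.

Lemma Psi_critical J : 4 * g = 1 -> Psi g J = J.+1%:R.
Proof. by move=> e; rewrite /Psi e; under eq_bigr do rewrite expr1n;
  rewrite sumr_const card_ord. Qed.

End ThetaAsymptotics.

(** S is a partial sum of the Green function, M = (L Y)^-d and T the time
scale of x, where Y = max(|x|, L) / L.  The target is a multiple of M T when the
minimum is 1, and of M / T (1 - mu)^-2 otherwise. *)
Lemma massive_combine (R : realType) (S C1 M T k1 k2 KC F a b mu : R) :
  0 <= mu <= 1 -> 0 < M -> 0 < T -> 0 < k1 -> 0 < k2 -> 0 < KC ->
  F = k1 * M * T -> a / b = k2 / T ^+ 2 -> C1 <= KC * k1 -> C1 <= KC * k1 * k2 ->
  S <= C1 * (M * T) -> (mu < 1 -> S <= C1 * (M / T) * ((1 - mu) ^+ 2)^-1) ->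
  S <= KC * F * min1_massive mu a b.
Proof.
move=> /andP[m0 m1] M0 T0 k10 k20 KC0 -> Hab h1 h2 S1 S2.
have B1 : S <= KC * (k1 * M * T).
  apply: le_trans S1 _; rewrite -[k1 * M * T]mulrA [leRHS]mulrA.
  by apply: ler_wpM2r => //; rewrite mulr_ge0 ?ltW.
rewrite /min1_massive; have [e|ne] := eqVneq mu 1; first by rewrite mulr1.
have mu1 : mu < 1 by rewrite lt_neqAle ne.
have p : 0 < (1 - mu) ^+ 2 by rewrite exprn_gt0// subr_gt0.
rewrite /Num.min; case: ifP => _; first by rewrite mulr1.
apply: le_trans (S2 mu1) _.
have -> : a / (b * (1 - mu) ^+ 2) = k2 / T ^+ 2 * ((1 - mu) ^+ 2)^-1.
  by rewrite -Hab -[RHS]mulrA -invfM.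
rewrite [leRHS]mulrA; apply: ler_wpM2r; first by rewrite invr_ge0 ltW.
have -> : KC * (k1 * M * T) * (k2 / T ^+ 2) = KC * k1 * k2 * (M / T).
  by field; rewrite gt_eqF.
by apply: ler_wpM2r => //; rewrite divr_ge0 ?ltW.
Qed.

Section Scale.
Variables (R : realType) (d : nat) (d_ge1 : (1 <= d)%N).
Variables (L : R) (x : 'rV[int]_d).
Hypothesis L1 : 1 <= L.
Let xR := vec_of_int R x.
(** Both norms of the statement are functions of this ratio. *)
Definition rel_scale : R := Num.max (eucl_norm xR) L / L.
Let L0 : 0 < L. Proof. exact: lt_le_trans L1. Qed.

Lemma rel_scale_ge1 : 1 <= rel_scale.
Proof. by rewrite ler_pdivlMr// mul1r le_max lexx orbT. Qed.

Lemma tnorm_L : tnorm L xR = pi / 2 * (L * rel_scale).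
Proof. by rewrite /tnorm /rel_scale [L * _]mulrC divfK// gt_eqF. Qed.

Lemma tnorm_1 : tnorm 1 (L^-1 *: xR) = pi / 2 * rel_scale.
Proof.
rewrite /tnorm /rel_scale; congr (_ * _).
have -> : eucl_norm (L^-1 *: xR) = eucl_norm xR / L.
  rewrite /eucl_norm; under eq_bigr do rewrite mxE exprMn.
  rewrite -mulr_sumr sqrtrM ?sqr_ge0// sqrtr_sqr ger0_norm ?invr_ge0 ?(ltW L0)//.
  exact: mulrC.
by rewrite maxr_pMl ?invr_ge0 ?(ltW L0)// divff ?gt_eqF.
Qed.

Lemma rel_scale_dyadic (A J : nat) : (0 < A)%N -> let l := Num.truncn L in
  J = 0%N \/ (2 ^ J * (A * l) <= supnorm x)%N -> (supnorm x <= 2 ^ J.+1 * (A * l))%N ->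
  2 ^+ J <= 2 * rel_scale /\ rel_scale <= (2 * d * A)%N%:R * 2 ^+ J.
Proof.
move=> A0 l; have [l0 lL Ll] := truncn_bounds L1; rewrite -/l in l0 lL Ll *.
move=> h1 h2; have J1 : 1 <= 2 ^+ J :> R by rewrite exprn_ege1// ler1n.
split.
  case: h1 => [->|h1]; first by rewrite expr0; have := rel_scale_ge1; lra.
  rewrite /rel_scale mulrA ler_pdivlMr//.
  apply: (@le_trans _ _ (2 * (supnorm x)%:R)); last first.
    rewrite ler_pM2l//; apply: le_trans (supnorm_le_eucl R x) _.
    by rewrite le_max lexx.
  apply: (@le_trans _ _ (2 ^+ J * (2 * l%:R))); first by rewrite ler_pM2l ?exprn_gt0.
  rewrite mulrCA ler_pM2l// -natrX -natrM ler_nat; apply: leq_trans h1.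
  by rewrite leq_mul2l leq_pmull ?orbT.
have d1 : (0 < 2 * d * A)%N by rewrite !muln_gt0 d_ge1 A0.
rewrite /rel_scale ler_pdivrMr// ge_max; apply/andP; split.
  apply: le_trans (eucl_le_supnorm R x) _.
  apply: (@le_trans _ _ ((2 * d * A)%N%:R * 2 ^+ J * l%:R)).
    rewrite -natrX -!natrM ler_nat.
    apply: leq_trans (leq_mul (leqnn d) h2) _; rewrite expnS.
    by rewrite eq_leq//; ring.
  by rewrite ler_wpM2l// mulr_ge0// exprn_ge0.
rewrite ler_peMl ?(ltW L0)// -[leLHS]mulr1; apply: ler_pM => //.
by rewrite ler1n.
Qed.

End Scale.

Section Final.
Variables (R : realType) (d : nat) (alpha KD : R).
Hypotheses (alpha_gt0 : 0 < alpha) (d_ge1 : (1 <= d)%N) (KD_ge1 : 1 <= KD).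
Hypothesis d_gt : Num.min alpha 2 < d%:R.
Local Notation V := 'rV[int]_d.
Local Notation g := (tail_ratio alpha).

(** Both cases say 2^min(alpha, 2) < 2^d. *)
Lemma transient_of_dim : 4 < 2 ^+ d :> R \/ g^-1 < 2 ^+ d.
Proof.
have H (p : R) : p < d%:R -> 2 `^ p < 2 ^+ d.
  move=> dim_alpha; rewrite -powR_mulrn// /powR gt_eqF// ltr_expR ltr_pM2r// ln_gt0//.
  by rewrite ltr1n.
move: d_gt; rewrite /Num.min; case: ifP => _ h; [right|left].
  by rewrite tail_ratio_inv; exact: H.
by have := H _ h; rewrite -natrX powR_mulrn// -natrX.
Qed.

Lemma theta_asym_noncritical : alpha != 2 -> exists2 C, 0 < C & forall J,
  theta g J <= C * (2 ^+ J) `^ (Num.min alpha 2) /\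
  (theta g J)^-1 <= C / (2 ^+ J) `^ (Num.min alpha 2).
Proof.
move=> a2; have g0 := tail_ratio_gt0 alpha.
have E (p : R) J : (2 ^+ J) `^ p = (2 `^ p) ^+ J :> R.
  by rewrite -[2 ^+ J]powR_mulrn// powRAC powR_mulrn// powR_ge0.
have p4 : 2 `^ 2 = 4 :> R by rewrite powR_mulrn// -natrX.
have [h|h] := ltP alpha 2.
  have g4 : 1 < 4 * g.
    rewrite -p4 /tail_ratio powRN ltr_pdivlMr ?powR_gt0// mul1r.
    by rewrite /powR gt_eqF// ltr_expR ltr_pM2r// ln_gt0// ltr1n.
  have [C C0 H] := theta_asym_gt g0 g4; exists C => // J.
  by rewrite E -tail_ratio_inv; exact: H.
have h' : 2 < alpha by rewrite lt_neqAle eq_sym a2.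
have g4 : 4 * g < 1.
  rewrite -p4 /tail_ratio powRN ltr_pdivrMr ?powR_gt0// mul1r.
  by rewrite /powR gt_eqF// ltr_expR ltr_pM2r// ln_gt0// ltr1n.
have [C C0 H] := theta_asym_lt g0 g4; exists C => // J.
by rewrite E p4; exact: H.
Qed.

(** At alpha = 2, Psi J = J + 1 is comparable to the logarithm of the distance.
That log (pi/2) > 0 matters only at bounded J. *)
Lemma theta_asym_critical (B : nat) : (0 < B)%N -> alpha = 2 ->
  exists2 C, 0 < C & forall J (Y : R),
  1 <= Y -> 2 ^+ J <= 2 * Y -> Y <= B%:R * 2 ^+ J ->
  [/\ 0 < ln (pi / 2 * Y), theta g J <= C * (Y ^+ 2 / ln (pi / 2 * Y)) &
    (theta g J)^-1 <= C / (Y ^+ 2 / ln (pi / 2 * Y))].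
Proof.
move=> B0 a2.
have g4 : 4 * g = 1.
  by rewrite /tail_ratio a2 powR_invn// -natrX divff// pnatr_eq0.
have p1 : 1 < pi / 2 :> R.
  rewrite lt_neqAle pihalf_ge1 andbT; apply/eqP => e.
  by have := cos1_gt0 R; rewrite e cos_pihalf ltxx.
have p2 := pihalf_lt2 R.
have k0 : 0 < ln (pi / 2 : R) by rewrite ln_gt0.
have l2 : 0 < ln (2 : R) by rewrite ln_gt0// ltr1n.
have BR : 1 <= B%:R :> R by rewrite ler1n.
pose C1 : R := 2 * B%:R + 2; pose C2 : R := (ln 2)^-1 + 2 / ln (pi / 2).
have C20 : 0 < C2 by rewrite addr_gt0 ?invr_gt0 ?divr_gt0.
have C10 : 0 < C1 by rewrite /C1; lra.
exists (4 * C1 + C2 * B%:R ^+ 2).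
  by rewrite addr_gt0 ?mulr_gt0 ?exprn_gt0//; lra.
move=> J Y Y1 h1 h2; set t := pi / 2 * Y.
have J0 : 0 < 2 ^+ J :> R by rewrite exprn_gt0.
have Y0 : 0 < Y by apply: lt_le_trans Y1.
have ph0 : 0 < pi / 2 :> R by apply: lt_trans p1.
have t0 : 0 < t by rewrite mulr_gt0.
have lnt1 : ln (pi / 2) <= ln t.
  by rewrite ler_ln ?posrE// ler_peMr// ltW.
have lnt0 : 0 < ln t by apply: lt_le_trans lnt1.
have up : ln t <= C1 * J.+1%:R.
  have tB : t <= 2 * B%:R * 2 ^+ J.
    rewrite -mulrA; apply: ler_pM => //; exact: ltW.
  have B2 : 0 < 2 * B%:R :> R by rewrite mulr_gt0//; lra.
  have : ln t <= ln (2 * B%:R * 2 ^+ J) by rewrite ler_ln ?posrE// mulr_gt0.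
  rewrite lnM ?posrE// lnXn// -[_ *+ J]mulr_natr => h.
  have h3 := ltW (ln_sublinear B2); have h4 := ltW (ln_sublinear (ltr0n R 2)).
  apply: le_trans h _; rewrite -[J.+1%:R]natr1 /C1.
  have : ln 2 * J%:R <= 2 * J%:R :> R by rewrite ler_wpM2r// ltW// ln_sublinear.
  have : 0 <= B%:R * J%:R :> R by rewrite mulr_ge0.
  move: h3; lra.
have lo : J.+1%:R <= C2 * ln t.
  have hJ : ln 2 * J%:R <= ln 2 + ln t.
    have h3 : 2 ^+ J <= 2 * t by apply: le_trans h1 _; rewrite ler_pM2l// ler_peMl ?ltW.
    have : ln (2 ^+ J) <= ln (2 * t) by rewrite ler_ln ?posrE// mulr_gt0.
    by rewrite lnM ?posrE// lnXn// -[_ *+ J]mulr_natr.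
  have hJ2 : J%:R <= 1 + ln t / ln 2.
    by rewrite -(ler_pM2l l2) mulrDr mulr1 [ln 2 * (_ / _)]mulrC divfK ?gt_eqF.
  have : 2 <= 2 / ln (pi / 2) * ln t.
    by rewrite mulrAC ler_pdivlMr// ler_pM2l.
  have -> : C2 * ln t = ln t / ln 2 + 2 / ln (pi / 2) * ln t by rewrite /C2; ring.
  by rewrite -[J.+1%:R]natr1; lra.
have tE : theta g J = (2 ^+ J) ^+ 2 / J.+1%:R.
  rewrite /theta Psi_critical// exprAC; congr (_ ^+ J / _).
  by rewrite -natrX.
have JR : 0 < J.+1%:R :> R by rewrite ltr0n.
split=> //.
  rewrite tE ler_pdivrMr// mulrA mulrAC ler_pdivlMr//.
  have a1 : (2 ^+ J) ^+ 2 <= 4 * Y ^+ 2.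
    have -> : 4 * Y ^+ 2 = (2 * Y) ^+ 2 by ring.
    by rewrite lerXn2r ?nnegrE ?mulr_ge0 ?(ltW J0) ?(ltW Y0).
  apply: (@le_trans _ _ (4 * Y ^+ 2 * (C1 * J.+1%:R))).
    by apply: ler_pM => //; rewrite ?exprn_ge0// ltW.
  have : 0 <= C2 * B%:R ^+ 2 * Y ^+ 2 * J.+1%:R.
    by rewrite !mulr_ge0 ?exprn_ge0// ltW.
  lra.
rewrite tE !invf_div mulrA ler_pdivrMr ?exprn_gt0// mulrAC ler_pdivlMr ?exprn_gt0//.
have a1 : Y ^+ 2 <= B%:R ^+ 2 * (2 ^+ J) ^+ 2.
  rewrite -exprMn lerXn2r ?nnegrE ?mulr_ge0 ?(ltW J0) ?(ltW Y0)//.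
apply: (@le_trans _ _ (C2 * ln t * (B%:R ^+ 2 * (2 ^+ J) ^+ 2))).
  by apply: ler_pM => //; rewrite ?exprn_ge0// ltW.
have : 0 <= 4 * C1 * ln t * (2 ^+ J) ^+ 2.
  by rewrite !mulr_ge0 ?exprn_ge0// ltW.
lra.
Qed.

End Final.

Section Assemble.
Variables (R : realType) (d : nat) (alpha KD : R).
Hypotheses (alpha_gt0 : 0 < alpha) (d_ge1 : (1 <= d)%N) (KD_ge1 : 1 <= KD).
Hypothesis d_gt : Num.min alpha 2 < d%:R.
Local Notation V := 'rV[int]_d.
Local Notation g := (tail_ratio alpha).

(** The bounds of green_bound with l and 2^J replaced by L and Y in the spatial
factor. *)
Lemma green_scaled : exists (B : nat) (C : R), [/\ (0 < B)%N, 0 < C &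
  forall (L Delta : R) (D : V -> R), 1 <= L -> assumptionA L alpha KD Delta D ->
  forall x, let Y := rel_scale L x in exists J : nat,
  [/\ 2 ^+ J <= 2 * Y, Y <= B%:R * 2 ^+ J,
   forall (mu : R) N, 0 <= mu <= 1 ->
     \sum_(1 <= n < N.+1) mu ^+ n * cpow D n x <= C * (L ^+ d * Y ^+ d)^-1 * theta g J &
   forall (mu : R) N, 0 <= mu < 1 ->
     \sum_(1 <= n < N.+1) mu ^+ n * cpow D n x <=
       C * (L ^+ d * Y ^+ d)^-1 / theta g J * ((1 - mu) ^+ 2)^-1]].
Proof.
have g0 := tail_ratio_gt0 alpha.
have [A [C [A0 C0 H]]] := green_bound d_ge1 g0 (tail_ratio_lt1 alpha_gt0) (lower_const_gt0
  alpha d_ge1 KD_ge1)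
  (upper_const_gt0 alpha KD_ge1) (transient_of_dim d_gt).
pose B := (2 * d * A)%N; have B0 : (0 < B)%N by rewrite !muln_gt0 d_ge1 A0.
exists B, (C * (2 ^+ d * B%:R ^+ d)); split=> //.
  by rewrite mulr_gt0// mulr_gt0 ?exprn_gt0// ltr0n.
move=> L Delta D L1 HA x Y.
have W := dyadic_kernel_of_assumptionA alpha_gt0 d_ge1 KD_ge1 L1 HA.
have [l0 lL Ll] := truncn_bounds L1.
have [J [h1 h2 S1 S2]] := H _ _ W x; exists J.
have [v1 v2] := rel_scale_dyadic d_ge1 L1 A0 h1 h2.
have L0 : 0 < L by apply: lt_le_trans L1.
have Y0 : 0 < Y by apply: lt_le_trans (rel_scale_ge1 x L1).
rewrite -/Y in v1 v2; clearbody Y.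
have lR : 0 < (Num.truncn L)%:R :> R by rewrite ltr0n.
have J0 : 0 < 2 ^+ J :> R by rewrite exprn_gt0.
have thJ := theta_gt0 g0 J.
have key : ((Num.truncn L)%:R ^+ d)^-1 / (2 ^+ d) ^+ J <=
  2 ^+ d * B%:R ^+ d * (L ^+ d * Y ^+ d)^-1.
  rewrite -invfM exprAC -exprMn -[L ^+ d * _]exprMn -[2 ^+ d * _]exprMn.
  rewrite ler_pdivlMr ?exprn_gt0 ?mulr_gt0//.
  rewrite mulrC ler_pdivrMr ?exprn_gt0 ?mulr_gt0// -exprMn.
  apply: lerXn2r; rewrite ?nnegrE; [exact: mulr_ge0 (ltW L0) (ltW Y0)| |].
    by apply: mulr_ge0; apply: mulr_ge0 => //; exact: ltW.
  have -> : 2 * B%:R * ((Num.truncn L)%:R * 2 ^+ J) = 2 * (Num.truncn L)%:R * (B%:R * 2 ^+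
    J) :> R by ring.
  exact: ler_pM (ltW L0) (ltW Y0) Ll v2.
split; [exact: v1|exact: v2|move=> mu N m01|move=> mu N m01].
  apply: le_trans (S1 mu N m01) _; apply: ler_wpM2r; first exact: ltW.
  by rewrite -!(mulrA C); apply: ler_wpM2l; [exact: ltW|].
apply: le_trans (S2 mu N m01) _; apply: ler_wpM2r.
  by rewrite invr_ge0 exprn_ge0// subr_ge0 ltW//; case/andP: m01.
apply: ler_wpM2r; first by rewrite invr_ge0 ltW.
by rewrite -!(mulrA C); apply: ler_wpM2l; [exact: ltW|].
Qed.

End Assemble.

Theorem proposition1p3 (R : realType) (d : nat) (alpha KD Delta : R)
    (alpha_gt0 : 0 < alpha) (d_ge1 : (1 <= d)%N)
    (d_gt : Num.min alpha 2 < d%:R)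
    (KD_ge1 : 1 <= KD) (Delta_gt0 : 0 < Delta) (Delta_lt1 : Delta < 1) :
  exists KC : R, 0 < KC /\
    forall (L : R) (D : 'rV[int]_d -> R),
      1 <= L -> assumptionA L alpha KD Delta D ->
      forall (mu : R) (x : 'rV[int]_d), 0 <= mu <= 1 ->
        let xR := vec_of_int R x in
        let t := tnorm 1 (L^-1 *: xR) in
        (alpha != 2 ->
          let a := Num.min alpha 2 in
          (two_point D mu x <=
            ((x == 0)%:R
             + KC / (L `^ a * tnorm L xR `^ (d%:R - a))
               * min1_massive mu 1 (t `^ (2 * a)))%:E)%E)
        /\
        (alpha = 2 ->
          (two_point D mu x <=
            ((x == 0)%:R
             + KC / (L ^+ 2 * tnorm L xR `^ (d%:R - 2) * ln t)
               * min1_massive mu (ln t ^+ 2) (t ^+ 4))%:E)%E).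
Proof.
have [B [C [B0 C0 H]]] := green_scaled alpha_gt0 d_ge1 KD_ge1 d_gt.
pose g := tail_ratio alpha; have g0 : 0 < g := tail_ratio_gt0 alpha.
have BR : 0 < B%:R :> R by rewrite ltr0n.
have h0 : 0 < pi / 2 :> R by rewrite divr_gt0// pi_gt0.
set a := Num.min alpha 2.
have [Ct Ct0 Hct] : exists2 Ct, 0 < Ct & forall J (Y : R),
  1 <= Y -> 2 ^+ J <= 2 * Y -> Y <= B%:R * 2 ^+ J ->
  let T := if alpha == 2 then Y ^+ 2 / ln (pi / 2 * Y) else Y `^ a in
  [/\ 0 < T, theta g J <= Ct * T & (theta g J)^-1 <= Ct / T].
  have [a2|a2] := eqVneq alpha 2.
    have [Ct Ct0 Hc] := theta_asym_critical B0 a2; exists Ct => // J Y Y1 v1 v2 /=.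
    have [l0 t1 t2] := Hc J Y Y1 v1 v2; split=> //.
    by rewrite divr_gt0// exprn_gt0// (lt_le_trans _ Y1).
  have [Ca Ca0 Hc] := theta_asym_noncritical a2.
  have B20 : 0 < 2 `^ a + B%:R `^ a by rewrite addr_gt0 ?powR_gt0.
  have a0 : 0 <= a by rewrite le_min (ltW alpha_gt0) ler0n.
  exists (Ca * (2 `^ a + B%:R `^ a)); first by rewrite mulr_gt0.
  move=> J Y Y1 v1 v2 /=; have Y0 : 0 < Y by apply: lt_le_trans Y1.
  have J0 : 0 < 2 ^+ J :> R by rewrite exprn_gt0.
  have T0 : 0 < Y `^ a by exact: powR_gt0.
  have [t1 t2] := Hc J; split=> //.
    apply: le_trans t1 _; rewrite -mulrA ler_pM2l//.
    apply: le_trans (powR_le a0 (ltW J0) v1) _.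
    by rewrite powRM ?(ltW Y0)// ler_wpM2r ?(ltW T0)// lerDl powR_ge0.
  apply: le_trans t2 _; rewrite -mulrA ler_pM2l//.
  rewrite ler_pdivlMr// mulrC ler_pdivrMr ?powR_gt0//.
  have := powR_le a0 (ltW Y0) v2; rewrite powRM ?(ltW BR) ?(ltW J0)// => h.
  apply: le_trans h _; rewrite ler_wpM2r ?powR_ge0// lerDr powR_ge0//.
pose C1 := C * Ct; have C10 : 0 < C1 by exact: mulr_gt0.
pose k1 : R := ((pi / 2) `^ (d%:R - a))^-1; have k10 : 0 < k1 by rewrite invr_gt0 powR_gt0.
pose k2 : R := ((pi / 2) `^ (2 * a))^-1; have k20 : 0 < k2 by rewrite invr_gt0 powR_gt0.
have [KC [KC0 KC1 KC2]] : exists KC : R,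
    [/\ 0 < KC, C1 <= KC * k1 & C1 <= KC * k1 * k2].
  clearbody k1 k2 C1; exists (C1 / k1 + C1 / (k1 * k2)); split.
  - by rewrite addr_gt0 ?divr_gt0 ?mulr_gt0.
  - have -> : (C1 / k1 + C1 / (k1 * k2)) * k1 = C1 + C1 / k2 by field; rewrite !gt_eqF.
    by rewrite lerDl divr_ge0 ?ltW.
  - have -> : (C1 / k1 + C1 / (k1 * k2)) * k1 * k2 = C1 + C1 * k2 by field; rewrite !gt_eqF.
    by rewrite lerDl mulr_ge0 ?ltW.
exists KC; split=> // L D L1 HA mu x m01 xR t.
have L0 : 0 < L by apply: lt_le_trans L1.
have m0 : 0 <= mu by case/andP: m01.
have [Ds _] := summ_tsumE (D_ge0 HA) (D_sum1 HA).
have [J [v1 v2 S1 S2]] := H L Delta D L1 HA x.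
set Y := rel_scale L x in v1 v2 S1 S2.
have Y1 : 1 <= Y by exact: rel_scale_ge1.
have Y0 : 0 < Y by apply: lt_le_trans Y1.
have tE : t = pi / 2 * Y by exact: tnorm_1.
have tLE : tnorm L xR = pi / 2 * (L * Y) by exact: tnorm_L.
clearbody Y.
have := Hct J Y Y1 v1 v2; set T := if _ then _ else _; move=> [T0 t1 t2].
set M := (L ^+ d * Y ^+ d)^-1 in S1 S2.
have M0 : 0 < M by rewrite invr_gt0 mulr_gt0 ?exprn_gt0.
have thJ := theta_gt0 g0 J.
have main F p q : F = k1 * M * T -> p / q = k2 / T ^+ 2 ->
    (two_point D mu x <= ((x == 0)%:R + KC * F * min1_massive mu p q)%:E)%E.
  move=> FE pqE; apply: two_point_le => // N.
  apply: (massive_combine m01 M0 T0 k10 k20 KC0 FE pqE KC1 KC2).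
    apply: le_trans (S1 mu N m01) _.
    have -> : C1 * (M * T) = C * M * (Ct * T) by rewrite /C1; ring.
    by rewrite ler_pM2l// mulr_gt0.
  move=> mu1; apply: le_trans (S2 mu N _) _; first by rewrite m0 mu1.
  apply: ler_wpM2r; first by rewrite invr_ge0 sqr_ge0.
  have -> : C1 * (M / T) = C * M * (Ct / T) by rewrite /C1; ring.
  by rewrite ler_pM2l// mulr_gt0.
have LY0 : 0 < L * Y by exact: mulr_gt0.
have LYd : (L * Y) `^ (d%:R - a) = (L * Y) ^+ d / (L * Y) `^ a.
  rewrite powRB; last by rewrite (gt_eqF LY0) implybT.
  by rewrite powR_mulrn// ltW.
have LYa : (L * Y) `^ a = L `^ a * Y `^ a by rewrite powRM ?ltW.
have pL : tnorm L xR `^ (d%:R - a) = k1^-1 * ((L * Y) ^+ d / (L `^ a * Y `^ a)).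
  rewrite tLE powRM ?(ltW h0)//; last by rewrite mulr_ge0 ?ltW.
  by rewrite LYd LYa /k1 invrK.
have La0 : 0 < L `^ a by exact: powR_gt0.
have Ya0 : 0 < Y `^ a by exact: powR_gt0.
have Ld0 : 0 < L ^+ d by exact: exprn_gt0.
have Yd0 : 0 < Y ^+ d by exact: exprn_gt0.
split=> a2.
  have TE : T = Y `^ a by rewrite /T (negbTE a2).
  apply: main.
    rewrite pL TE /M exprMn; field.
    by rewrite !gt_eqF.
  rewrite tE powRM ?(ltW h0) ?(ltW Y0)// TE /k2.
  have -> : Y `^ (2 * a) = (Y `^ a) ^+ 2 by rewrite mulrC powRrM powR_mulrn// ltW.
  by rewrite mul1r invfM.
have TE : T = Y ^+ 2 / ln t by rewrite /T a2 eqxx tE.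
have aE : a = 2 by rewrite /a a2 minxx.
have lnt0 : 0 < ln t.
  move: T0; rewrite TE pmulr_rgt0 ?invr_gt0// exprn_gt0//.
have L2 : L `^ a = L ^+ 2 by rewrite aE powR_mulrn// ltW.
have Y2 : Y `^ a = Y ^+ 2 by rewrite aE powR_mulrn// ltW.
have Y20 : 0 < Y ^+ 2 by exact: exprn_gt0.
apply: main.
  rewrite -aE pL -L2 TE /M exprMn -Y2; field.
  by rewrite !gt_eqF.
have k2E : k2 = ((pi / 2) ^+ 4)^-1.
  by rewrite /k2 aE -natrM powR_mulrn// ltW.
have t4 : t ^+ 4 = (pi / 2) ^+ 4 * Y ^+ 4 by rewrite tE exprMn.
rewrite TE k2E t4; move: (pi / 2) (ln t) h0 lnt0 => h q h_gt0 q_gt0.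
by field; rewrite !gt_eqF.
Qed.
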